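(* Let $G$ be a countable discrete group generated by a finite symmetric set $S=S^{-1}$ with $e\notin S$ and $|S|=k$, and let $\ell$ be the word length function on $G$ with respect to $S$. Let $G$ act by $*$-automorphisms $\alpha_g$ on an injective von Neumann algebra $\mathcal{R}$ on a Hilbert space $H$. Then there exist a unital completely positive $\Psi(\mathcal{R})$-bimodular mapping $\sigma:B(H\otimes\ell_2(G))\to\mathcal{L}(\mathcal{R},\alpha,G)$ and a positive definite function $\chi$ on $G$ such that $\sigma(L_g\Psi(r))=\chi(g)L_g\Psi(r)$ for all $g\in G$, $r\in\mathcal{R}$, and $$\chi(g)\ge\frac{k-2}{(k-1)^{\ell(g)+1}-1}\quad\text{for all } g\in G.$$
   Context: Here $e$ is the unit of $G$, and $\ell(g)$ is the smallest number of elements of $S$ whose product is $g$, with $\ell(e)=0$. Let $\lambda_g$ be the left translation unitaries on $\ell_2(G)$, $\lambda_g\delta_h=\delta_{gh}$, where $(\delta_g)_{g\in G}$ is the canonical orthonormal basis, and let $(e_{(g,h)})_{g,h\in G}$ be the canonical matrix units of $B(\ell_2(G))$. Define $L_g:=I_H\otimes\lambda_g$ and the normal faithful representation $\Psi(r):=\sum_{g\in G}\alpha_{g^{-1}}(r)\otimes e_{(g,g)}$ of $\mathcal{R}$ on $H\otimes\ell_2(G)$. The crossed product von Neumann algebra $\mathcal{L}(\mathcal{R},\alpha,G)$ is the ultra-weak closure of $\mathrm{span}\{L_g\Psi(r): g\in G, r\in\mathcal{R}\}$ in $B(H\otimes\ell_2(G))$. $\Psi(\mathcal{R})$-bimodular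 means $\sigma(\Psi(r)x\Psi(s))=\Psi(r)\sigma(x)\Psi(s)$ for $r,s\in\mathcal{R}$ and $x\in B(H\otimes\ell_2(G))$.
   Formalization: For k = 2 the displayed lower bound reads 0/0 and is undefined; it is taken there to be its limit 1/(ℓ(g)+1), the value of 1/(1+(k-1)+...+(k-1)^{ℓ(g)}); for every other k the bound is as printed. *)

(* Defs.v *)
From HB Require Import structures.
From mathcomp Require Import all_boot all_order all_algebra finmap.
From mathcomp Require Import sesquilinear.
From mathcomp Require Import all_classical reals topology normedtype summability.
From mathcomp Require Import complex ring lra.

Set Implicit Arguments.
Unset Strict Implicit.
Unset Printing Implicit Defensive.

Import Order.TTheory GRing.Theory Num.Theory.
Import numFieldNormedType.Exports.

Local Open Scope classical_set_scope.
Local Open Scope ring_scope.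
Local Open Scope complex_scope.

(* The scalar field is R[i] for an arbitrary R : realType; inner products are
   linear in the first variable and conjugate-linear in the second. *)
HB.mixin Record isHilbert (R : realType) H of CompleteNormedModule R[i] H := {
  dot : {dot H for Num.conj};
  dot_norm : forall u : H, dot u u = `|u| ^+ 2 }.

#[short(type="hilbertType")]
HB.structure Definition Hilbert (R : realType) :=
  {H of CompleteNormedModule R[i] H & isHilbert R H}.

Section complex_sums.
Variable R : realType.
Local Notation C := R[i].

Lemma normc_Re_le (z : C) : `|(complex.Re z)%:C| <= `|z|.
Proof.
case: z => a b; rewrite !normc_def lecR /=.
by rewrite ler_sqrt ?addr_ge0 ?sqr_ge0// expr0n /= addr0 lerDl sqr_ge0.
Qed.

Lemma normc_Im_le (z : C) : `|(complex.Im z)%:C| <= `|z|.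
Proof.
case: z => a b; rewrite !normc_def lecR /=.
by rewrite ler_sqrt ?addr_ge0 ?sqr_ge0// expr0n /= addr0 lerDr sqr_ge0.
Qed.

Lemma normcR (x : R) : `|x%:C| = `|x|%:C.
Proof. by rewrite normc_def /= expr0n addr0 sqrtr_sqr. Qed.

Lemma complex_complete (F : set_system C^o) :
  ProperFilter F -> cauchy F -> cvg F.
Proof.
move=> FF /cauchy_ballP Fc.
have part (p : C -> R) : {morph p : x y / x - y} ->
    (forall z, `|(p z)%:C| <= `|z|) -> cvg (p @ F).
  move=> pB ple; apply: cauchy_cvg; apply/cauchy_ballP => e e0.
  have e0' : 0 < e%:C by rewrite (_ : 0 = 0%:C) // ltcR.
  have := Fc _ e0'; rewrite /nearP_dep.
  case=> -[A B] /= [FA FB] AB.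
  exists (p @` A, p @` B); first by split; rewrite /= ?nbhs_simpl /=;
    [apply: filterS FA|apply: filterS FB] => x /= Ax; exists x.
  move=> [_ _] [/= [x Ax <-] [y By <-]]; rewrite /ball /= -pB.
  have := AB (x, y) (conj Ax By); rewrite /ball /= => xy.
  by rewrite -ltcR -normcR; apply: le_lt_trans xy.
have /cvg_ex[/= a Fa] := part (@complex.Re R) (raddfB (@complex.Re R)) normc_Re_le.
have /cvg_ex[/= b Fb] := part (@complex.Im R) (raddfB (@complex.Im R)) normc_Im_le.
apply/cvg_ex; exists (a +i* b : C^o).
apply/cvgrPdist_lt => e e0.
have [er eE] : exists er : R, e = er%:C.
  by exists (complex.Re e); rewrite RRe_real // gtr0_real.
have er0 : 0 < er / 2 by rewrite divr_gt0 // -ltcR -eE.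
have A1 : \forall z \near F, `|a - complex.Re z| < er / 2.
  by have /cvgrPdist_lt := Fa; apply.
have A2 : \forall z \near F, `|b - complex.Im z| < er / 2.
  by have /cvgrPdist_lt := Fb; apply.
near=> z.
have -> : (a +i* b : C) - z =
    (a - complex.Re z)%:C + 'i%C * (b - complex.Im z)%:C.
  by rewrite [LHS]complexE; case: (z).
apply: (le_lt_trans (ler_normD _ _)); rewrite normrM.
have -> : `|'i%C : C| = 1 by rewrite normc_def /= expr0n expr1n add0r sqrtr1.
rewrite mul1r !normcR eE -rmorphD /= ltcR (splitr er) ltrD //.
- by near: z.
- by near: z.
Unshelve. all: by end_near. Qed.

End complex_sums.

Section unconditional_sums.
Variable R : realType.
Local Notation C := R[i].

Lemma cvgC_ge (T : Type) (F : set_system T) (FF : ProperFilter F)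
    (f : T -> C^o) (l : C^o) (c : C) :
  f @ F --> l -> (\forall x \near F, c <= f x) -> c <= l.
Proof.
move=> /cvgrPdist_lt fl cf; rewrite -subr_ge0 ger0_def -subr_eq0.
apply/negPn/negP; rewrite -normr_gt0; set d := `|_| => d0.
have /(_ (d / 2)) := fl _; rewrite divr_gt0// => /(_ isT) fd.
have [x [/= cx lx]] := filter_ex (filterI cf fd).
suff : d <= `|l - f x| + `|l - f x|.
  move=> /le_lt_trans /(_ (ltrD lx lx)); rewrite -splitr ltxx //.
have fc : `|f x - c| = f x - c by rewrite ger0_norm// subr_ge0.
rewrite /d (_ : _ - _ = (`|l - c| - `|f x - c|) + (f x - l)); last first.
  by rewrite fc; ring.
apply: (le_trans (ler_normD _ _)); rewrite (distrC _ l) lerD2r.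
by apply: (le_trans (ler_dist_dist _ _)); rewrite opprB addrA subrK.
Qed.

Lemma cvgC_le (T : Type) (F : set_system T) (FF : ProperFilter F)
    (f : T -> C^o) (l : C^o) (c : C) :
  f @ F --> l -> (\forall x \near F, f x <= c) -> l <= c.
Proof.
move=> fl fc; rewrite -lerN2.
apply: (@cvgC_ge _ F _ (fun x => - f x)); first exact: (cvgN fl).
by apply: filterS fc => x; rewrite lerN2.
Qed.

Variable I : choiceType.
Implicit Types (f : I -> C) (A B : {fset I}).

Lemma partial_sumE f A : partial_sum (f : I -> C^o) A = \sum_(i <- A) f i.
Proof. by rewrite big_seq_fsetE. Qed.

Lemma sum_fsetD f A B : (A `<=` B)%fset ->
  \sum_(i <- B) f i - \sum_(i <- A) f i = \sum_(i <- (B `\` A)%fset) f i.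
Proof.
move=> /fsetIidPr AB; rewrite (big_fsetID _ (mem A) B) /=.
have -> : [fset x in B | x \in A]%fset = A by rewrite -[RHS]AB; apply/fsetP => x; rewrite !inE.
have -> : [fset x in B | x \notin A]%fset = (B `\` A)%fset.
  by apply/fsetP => x; rewrite !inE andbC.
by rewrite addrAC subrr add0r.
Qed.

Definition abs_summable f :=
  exists M : C, forall A, \sum_(i <- A) `|f i| <= M.

Lemma sum_cvg f : abs_summable f ->
  partial_sum (f : I -> C^o) @ totally --> (sum (f : I -> C^o) : C^o).
Proof.
have tF := @totally_filter I.
move=> [M fM]; apply: complex_complete; apply: cauchy_exP => e e0.
pose s A := complex.Re (\sum_(i <- A) `|f i|).
have sE A : \sum_(i <- A) `|f i| = (s A)%:C.
  by rewrite RRe_real// ger0_real// sumr_ge0.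
have MR : M = (complex.Re M)%:C.
  by rewrite RRe_real// ger0_real// (le_trans _ (fM fset0))// sumr_ge0.
have hs : has_sup (range s).
  split; first by exists (s fset0); exists fset0.
  by exists (complex.Re M) => _ [A _ <-]; rewrite -lecR -sE -MR.
have eE : e = (complex.Re e)%:C by rewrite RRe_real// gtr0_real.
have e0' : 0 < complex.Re e by rewrite -ltcR -eE.
have [_ [A _ <-] sA] := sup_adherent e0' hs.
exists (partial_sum (f : I -> C^o) A); exists A => // B /= AB.
rewrite /ball /= !partial_sumE distrC sum_fsetD//.
apply: (le_lt_trans (ler_norm_sum _ _ _)).
rewrite -(sum_fsetD (fun i => `|f i|))// !sE eE -rmorphB ltcR.
rewrite ltrBlDr -ltrBlDl; apply: le_lt_trans sA.
by rewrite lerD2r; apply: sup_upper_bound => //; exists B.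
Qed.

Lemma C_hausdorff : hausdorff_space C^o.
Proof. exact: norm_hausdorff. Qed.

Lemma sum_eq f (l : C^o) :
  partial_sum (f : I -> C^o) @ totally --> l -> sum (f : I -> C^o) = l.
Proof. by have tF := @totally_filter I => /(cvg_lim C_hausdorff). Qed.

Lemma sum_lin (a : C) f g : abs_summable f -> abs_summable g ->
  sum ((fun i => a * f i + g i) : I -> C^o) =
  a * sum (f : I -> C^o) + sum (g : I -> C^o).
Proof.
have tF := @totally_filter I.
move=> /sum_cvg fS /sum_cvg gS; apply: sum_eq.
have -> : partial_sum ((fun i => a * f i + g i) : I -> C^o) =
    (fun A => a *: partial_sum (f : I -> C^o) A + partial_sum (g : I -> C^o) A).
  by apply/funext => A; rewrite !partial_sumE big_split /= -big_distrr.
by apply: cvgD gS; apply: cvgZr.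
Qed.

Lemma sum_conj f : abs_summable f ->
  sum ((fun i => (f i)^*%R) : I -> C^o) = (sum (f : I -> C^o))^*%R.
Proof.
have tF := @totally_filter I.
move=> /sum_cvg fS; apply: sum_eq.
apply/cvgrPdist_lt => e e0.
have /cvgrPdist_lt /(_ e e0) := fS.
apply: filterS => A; rewrite !partial_sumE -rmorph_sum -rmorphB.
by rewrite norm_conjC.
Qed.

Lemma sum_ge f (c : C) (A0 : {fset I}) : abs_summable f ->
  (forall A, (A0 `<=` A)%fset -> c <= \sum_(i <- A) f i) ->
  c <= sum (f : I -> C^o).
Proof.
have tF := @totally_filter I.
move=> /sum_cvg fS cf; apply: (cvgC_ge _ fS); exists A0 => // A /= /cf.
by rewrite partial_sumE.
Qed.

Lemma sum_le f (c : C) : abs_summable f ->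
  (forall A, \sum_(i <- A) f i <= c) -> sum (f : I -> C^o) <= c.
Proof.
have tF := @totally_filter I.
move=> /sum_cvg fS cf; apply: (cvgC_le _ fS); exists fset0 => // A _.
by rewrite partial_sumE.
Qed.

End unconditional_sums.

Section dot_norm.
Variables (C : numClosedFieldType) (U : lmodType C) (d : {dot U for Num.conj}).

Lemma dot_CauchySchwarz (u v : U) : `|d u v| ^+ 2 <= d u u * d v v.
Proof.
have [->|v0] := eqVneq v 0; first by rewrite !linear0r normr0 expr0n /= mulr0.
have vv : 0 < d v v by rewrite neq0_dnorm_gt0.
have := dnorm_ge0 d (d v v *: u - d u v *: v).
rewrite dnormB !dnormZ (ger0_norm (ltW vv)).
rewrite linearZl_LR /= linearZr_LR /= !rmorphM /= conjCK (geC0_conj (ltW vv)).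
have -> : d v v * ((d u v)^*%R * d u v) + d v v * (d u v * (d u v)^*%R) =
  d v v * (`|d u v| ^+ 2) + d v v * (`|d u v| ^+ 2) by rewrite normCK; ring.
have -> : d v v ^+ 2 * d u u + `|d u v| ^+ 2 * d v v -
  (d v v * `|d u v| ^+ 2 + d v v * `|d u v| ^+ 2) =
  d v v * (d u u * d v v - `|d u v| ^+ 2) by ring.
by rewrite pmulr_rge0 // subr_ge0.
Qed.

Lemma dot_abs_le (u v : U) : `|d u v| <= d u u + d v v.
Proof.
have u0 := dnorm_ge0 d u; have v0 := dnorm_ge0 d v.
rewrite -(@ler_pXn2r _ 2) ?nnegrE ?addr_ge0//.
apply: (le_trans (dot_CauchySchwarz u v)).
rewrite sqrrD -addrA addrCA -mulr_natr mulrDr mulr1.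
rewrite -addrA lerDl ?addr_ge0 ?mulr_ge0 ?exprn_ge0//.
Qed.

Lemma dot_triangle (u v : U) :
  sqrtC (d (u + v) (u + v)) <= sqrtC (d u u) + sqrtC (d v v).
Proof.
rewrite -ler_sqr ?nnegrE ?addr_ge0 ?sqrtC_ge0//.
rewrite sqrrD !sqrtCK addrAC dnormD lerD2l.
rewrite -mulr_natr -[_ + _](divfK (negbT (pnatr_eq0 C 2))) -ReE.
rewrite ler_pM2r ?ltr0n//.
apply: (le_trans (leif_Re_Creal _).1).
rewrite -ler_sqr ?nnegrE ?mulr_ge0 ?sqrtC_ge0// exprMn !sqrtCK.
exact: dot_CauchySchwarz.
Qed.

End dot_norm.

(* l2 I H is the space of square-summable families I -> H, that is, the
   Hilbert space tensor product of H and l2(I), with the elementary tensor of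
   u and the basis vector at i being the family with u at i and 0 elsewhere. *)
Section l2.
Variables (R : realType) (I : choiceType) (H : hilbertType R).
Local Notation C := R[i].

Definition square_summable : {pred I -> H} := [pred f : I -> H |
  `[< exists M : C, forall A : {fset I}, \sum_(i <- A) `|f i| ^+ 2 <= M >]].

Lemma square_summable_submod : submod_closed square_summable.
Proof.
split; first by apply/asboolP; exists 0 => A; rewrite big1// => i _; rewrite normr0 expr0n.
move=> a f g /asboolP[M fM] /asboolP[N gN].
apply/asboolP; exists ((`|a| ^+ 2 * M + N) *+ 2) => A.
apply: (@le_trans _ _ (\sum_(i <- A) (`|a| ^+ 2 * `|f i| ^+ 2 + `|g i| ^+ 2) *+ 2)).
  apply: ler_sum => i _; set x := a *: f i; set y := g i.
  have -> : (a *: f + g) i = x + y by [].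
  have -> : `|a| ^+ 2 * `|f i| ^+ 2 = `|x| ^+ 2 by rewrite normrZ exprMn.
  rewrite -!dot_norm dnormD -subr_ge0.
  have := dnorm_ge0 dot (x - y); rewrite dnormB; congr (_ <= _).
  by rewrite mulr2n; ring.
rewrite sumrMnl lerMn2r /= big_split /= -mulr_sumr lerD ?ler_wpM2l ?exprn_ge0//.
Qed.

HB.instance Definition _ :=
  GRing.isSubmodClosed.Build C (I -> H) square_summable square_summable_submod.

Record l2 := L2 { l2_fun :> I -> H; l2_fun_subproof : l2_fun \in square_summable }.

HB.instance Definition _ := [isSub for l2_fun].
HB.instance Definition _ := [Choice of l2 by <:].
HB.instance Definition _ := [SubChoice_isSubLmodule of l2 by <:].

Lemma eq_csum (f g : I -> C) : f =1 g ->
  sum (f : I -> C^o) = sum (g : I -> C^o) :> C.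
Proof. by move=> /funext ->. Qed.

Definition l2_dot (f g : l2) : C := sum ((fun i => dot (f i) (g i)) : I -> C^o).

Lemma l2P (f : l2) : exists M : C, forall A : {fset I}, \sum_(i <- A) `|f i| ^+ 2 <= M.
Proof. by case: f => f /= /asboolP. Qed.

Lemma l2_abs (f g : l2) : abs_summable (fun i => dot (f i) (g i)).
Proof.
have [M fM] := l2P f; have [N gN] := l2P g; exists (M + N) => A.
apply: (@le_trans _ _ (\sum_(i <- A) (`|f i| ^+ 2 + `|g i| ^+ 2))).
  by apply: ler_sum => i _; rewrite -!dot_norm; exact: dot_abs_le.
by rewrite big_split lerD.
Qed.

Lemma l2_dotC f g : l2_dot f g = (l2_dot g f)^*%R.
Proof.
rewrite /l2_dot -sum_conj; last exact: l2_abs.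
by apply: eq_csum => i; rewrite hermC expr0 mul1r.
Qed.

Lemma l2_dot_sesqui : bilinear_for *%R (Num.conj \; *%R) l2_dot.
Proof.
have lin g a (f1 f2 : l2) : l2_dot (a *: f1 + f2) g = a * l2_dot f1 g + l2_dot f2 g.
  rewrite /l2_dot -sum_lin; try exact: l2_abs.
  by apply: eq_csum => i; rewrite linearPl.
split=> [g a f1 f2|f a g1 g2] /=; first exact: lin.
by rewrite [LHS]l2_dotC lin rmorphD rmorphM [in RHS](l2_dotC f g1) [in RHS](l2_dotC f g2).
Qed.

HB.instance Definition _ :=
  bilinear_isBilinear.Build C l2 l2 C *%R (Num.conj \; *%R) l2_dot l2_dot_sesqui.

Lemma l2_dot_herm (f g : l2) : l2_dot f g = (-1) ^+ false * (l2_dot g f)^*%R.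
Proof. by rewrite expr0 mul1r l2_dotC. Qed.

HB.instance Definition _ :=
  isHermitianSesquilinear.Build C l2 false Num.conj l2_dot l2_dot_herm.

Lemma l2_dot_ge (f : l2) (A : {fset I}) : \sum_(i <- A) `|f i| ^+ 2 <= l2_dot f f.
Proof.
apply: (sum_ge (l2_abs f f) (A0 := A)) => B AB.
under [leRHS]eq_bigr do rewrite dot_norm.
by rewrite -subr_ge0 (sum_fsetD _ AB) sumr_ge0// => i _; rewrite exprn_ge0.
Qed.

Lemma l2_dot_le (f : l2) (c : C) :
  (forall A : {fset I}, \sum_(i <- A) `|f i| ^+ 2 <= c) -> l2_dot f f <= c.
Proof.
move=> fc; apply: (sum_le (l2_abs f f)) => A; apply: le_trans (fc A).
by apply: ler_sum => i _; rewrite dot_norm.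
Qed.

Lemma l2_le (f : l2) i : `|f i| ^+ 2 <= l2_dot f f.
Proof. by have := l2_dot_ge f [fset i]%fset; rewrite big_seq_fset1. Qed.

Lemma l2_dot_gt0 (f : l2) : f != 0 -> 0 < l2_dot f f.
Proof.
move=> f0; suff [i fi] : exists i, f i != 0.
  by apply: lt_le_trans (l2_le f i); rewrite exprn_gt0// normr_gt0.
apply: contrapT => nfi; move: f0; apply/negP; rewrite negbK.
apply/eqP/val_inj/funext => i /=; apply/eqP/negPn/negP => fi.
by apply: nfi; exists i.
Qed.

HB.instance Definition _ := isDotProduct.Build C l2 l2_dot l2_dot_gt0.

Definition l2_norm (f : l2) : C := sqrtC (l2_dot f f).

Lemma l2_normD f g : l2_norm (f + g) <= l2_norm f + l2_norm g.
Proof. exact: dot_triangle. Qed.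

Lemma l2_normZ (a : C) f : l2_norm (a *: f) = `|a| * l2_norm f.
Proof.
rewrite /l2_norm dnormZ sqrtCM ?nnegrE ?exprn_ge0 ?dnorm_ge0//.
by rewrite sqrCK.
Qed.

Lemma l2_norm_eq0 f : l2_norm f = 0 -> f = 0.
Proof. by move=> /eqP; rewrite sqrt_dnorm_eq0 => /eqP. Qed.

HB.instance Definition _ :=
  Lmodule_isNormed.Build C l2 l2_normD l2_normZ l2_norm_eq0.

Lemma l2_normE (f : l2) : `|f| ^+ 2 = l2_dot f f.
Proof. exact: sqrtCK. Qed.

Lemma l2_complete (F : set_system l2) : ProperFilter F -> cauchy F -> cvg F.
Proof.
move=> FF /cauchyP Fc.
have evle (f g : l2) i : `|f i - g i| <= `|f - g|.
  rewrite -(@ler_pXn2r _ 2) ?nnegrE// l2_normE; exact: (l2_le (f - g) i).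
have evc i : cvg ((fun f : l2 => f i) @ F).
  apply: cauchy_cvg; apply: cauchy_exP => e e0.
  have [f Ff] := Fc e e0; exists (f i); rewrite /= nbhs_simpl.
  apply: filterS Ff => g; rewrite -!ball_normE /=.
  exact: le_lt_trans (evle f g i).
pose l i : H := lim ((fun f : l2 => f i) @ F).
have part (e : C) : 0 < e -> F [set f : l2 | forall A : {fset I},
    \sum_(i <- A) `|f i - l i| ^+ 2 <= e ^+ 2].
  move=> e0; have [g Fg] := Fc (e / 2) (divr_gt0 e0 (ltr0n _ 2)).
  apply: filterS (Fg) => f gf A.
  have lc : (fun h : l2 => \sum_(i <- A) `|f i - h i| ^+ 2 : C^o) @ F -->
      (\sum_(i <- A) `|f i - l i| ^+ 2 : C^o).
    apply: cvg_big => [|i _]; first exact: add_continuous.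
    have nc : (fun h : l2 => `|f i - h i| : C^o) @ F --> (`|f i - l i| : C^o).
      by apply: cvg_norm; apply: cvgB; [exact: cvg_cst|exact: evc].
    by rewrite expr2; apply: (cvgM nc nc).
  apply: (cvgC_le FF lc); apply: filterS Fg => h gh.
  apply: (@le_trans _ _ (`|f - h| ^+ 2)).
    by rewrite l2_normE; exact: (l2_dot_ge (f - h) A).
  rewrite lerXn2r ?nnegrE ?(ltW e0)// (splitr e).
  move: gf gh; rewrite -!ball_normE /= => gf gh.
  by apply: (le_trans (ler_distD g _ _)); rewrite lerD// ltW// distrC.
have lS : l \in square_summable.
  have [f fl] := filter_ex (part 1 ltr01).
  have -> : l = (f : I -> H) - ((f : I -> H) - l) by rewrite opprB addrC subrK.
  apply: rpredB; first exact: valP.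
  by apply/asboolP; exists (1 ^+ 2).
apply/cvg_ex; exists (L2 lS); apply/cvgrPdist_lt => e e0.
apply: filterS (part (e / 2) (divr_gt0 e0 (ltr0n _ 2))) => f fl.
have ee : e / 2 < e by rewrite ltr_pdivrMr// ltr_pMr// ltr1n.
apply: le_lt_trans ee; rewrite distrC.
rewrite -(@ler_pXn2r _ 2) ?nnegrE ?divr_ge0 ?(ltW e0)// l2_normE.
exact: l2_dot_le.
Qed.

HB.instance Definition _ := Uniform_isComplete.Build l2 l2_complete.

Lemma l2_dot_norm (f : l2) : (l2_dot : {dot l2 for Num.conj}) f f = `|f| ^+ 2.
Proof. by rewrite l2_normE. Qed.

HB.instance Definition _ := isHilbert.Build R l2 l2_dot_norm.

End l2.

Section bounded_operators.
Variables (R : realType) (H : hilbertType R).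
Local Notation C := R[i].

Definition bounded_linear : {pred H -> H} := [pred f : H -> H |
  `[< linear f /\ exists M : C, forall u, `|f u| <= M * `|u| >]].

Lemma bounded_linear_submod : submod_closed bounded_linear.
Proof.
split.
  apply/asboolP; split; first by move=> a u v; rewrite /= scaler0 addr0.
  by exists 0 => u; rewrite mul0r normr0.
move=> a f g /asboolP[fl [M fM]] /asboolP[gl [N gN]]; apply/asboolP; split.
  move=> b u v; rewrite -[LHS]/(a *: f (b *: u + v) + g (b *: u + v)).
  rewrite fl gl -[RHS]/(b *: (a *: f u + g u) + (a *: f v + g v)).
  by rewrite !scalerDr !scalerA mulrC addrACA.
exists (`|a| * M + N) => u; rewrite -[(a *: f + g) u]/(a *: f u + g u).
by rewrite mulrDl -mulrA (le_trans (ler_normD _ _))// normrZ lerD// ler_wpM2l.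
Qed.

HB.instance Definition _ :=
  GRing.isSubmodClosed.Build C (H -> H) bounded_linear bounded_linear_submod.

Record bop := Bop { bop_fun :> H -> H; bop_subproof : bop_fun \in bounded_linear }.

HB.instance Definition _ := [isSub for bop_fun].
HB.instance Definition _ := [Choice of bop by <:].
HB.instance Definition _ := [SubChoice_isSubLmodule of bop by <:].

Lemma bopP (x : bop) : linear x /\ exists M : C, forall u, `|x u| <= `|M| * `|u|.
Proof.
case: x => f /= /asboolP[fl [M fM]]; split=> //; exists M => u.
have fu := fM u; have := ger0_norm (le_trans (normr_ge0 _) fu).
by rewrite normrM normr_id => ->.
Qed.

Lemma bop_one_subproof : (id : H -> H) \in bounded_linear.
Proof. by apply/asboolP; split=> //; exists 1 => u; rewrite mul1r. Qed.

Lemma bop_mul_subproof (x y : bop) : (x \o y : H -> H) \in bounded_linear.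
Proof.
have [xl [M xM]] := bopP x; have [yl [N yN]] := bopP y.
apply/asboolP; split; first by move=> a u v; rewrite /= yl xl.
by exists (`|M| * `|N|) => u; rewrite -mulrA (le_trans (xM _))// ler_wpM2l.
Qed.

Definition bop_one := Bop bop_one_subproof.
Definition bop_mul x y := Bop (bop_mul_subproof x y).

Lemma bop_mulA : associative bop_mul. Proof. by move=> *; exact: val_inj. Qed.
Lemma bop_mul1l : left_id bop_one bop_mul. Proof. by move=> *; exact: val_inj. Qed.
Lemma bop_mul1r : right_id bop_one bop_mul. Proof. by move=> *; exact: val_inj. Qed.
Lemma bop_mulDl : left_distributive bop_mul +%R.
Proof. by move=> *; exact: val_inj. Qed.
Lemma bop_mulDr : right_distributive bop_mul +%R.
Proof.
move=> x y z; apply/val_inj/funext => u /=.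
have [xl _] := bopP x; rewrite -[RHS]/(x (y u) + x (z u)).
by have := xl 1 (y u) (z u); rewrite !scale1r.
Qed.

(* Multiplication is composition of operators. *)
HB.instance Definition _ := GRing.Zmodule_isPzRing.Build bop
  bop_mulA bop_mul1l bop_mul1r bop_mulDl bop_mulDr.

Definition is_adjoint (x y : bop) := forall u v : H, dot (x u) v = dot u (y v).

Definition star_closed (M : set bop) :=
  forall x, M x -> exists2 y, M y & is_adjoint x y.

Definition commutant (M : set bop) : set bop :=
  [set x | forall y, M y -> x * y = y * x].

(* A double commutant is automatically a unital subalgebra. *)
Definition von_neumann_algebra (M : set bop) :=
  star_closed M /\ commutant (commutant M) = M.

Definition operator_system (S : set bop) :=
  [/\ S 1, forall (a : C) x y, S x -> S y -> S (a *: x + y) & star_closed S].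

(* Positivity of a matrix of operators, as an operator on the direct sum of n
   copies of H. *)
Definition mx_positive n (x : 'M[bop]_n) :=
  forall xi : 'I_n -> H, 0 <= \sum_i \sum_j dot (x i j (xi j)) (xi i).

Definition linear_span (A : set bop) : set bop :=
  [set x | exists n (c : 'I_n -> C) (a : 'I_n -> bop),
    (forall i, A (a i)) /\ x = \sum_i c i *: a i].

(* The ultra-weak topology is the one induced by the functionals
   x |-> \sum_n <x xi_n, eta_n> with xi, eta square-summable sequences. *)
Definition ultraweak_form (xi eta : l2 nat H) (x : bop) : C :=
  sum ((fun n => dot (x (xi n)) (eta n)) : nat -> C^o).

Definition ultraweak_closure (A : set bop) : set bop :=
  [set x | forall (s : seq (l2 nat H * l2 nat H)) (e : R), 0 < e ->
    exists2 a, A a &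
      {in s, forall p, `|ultraweak_form p.1 p.2 (x - a)| < e%:C}].

End bounded_operators.

Definition completely_positive_on (R : realType) (K H : hilbertType R)
    (S : set (bop K)) (phi : bop K -> bop H) :=
  (forall (a : R[i]) x y, S x -> S y -> phi (a *: x + y) = a *: phi x + phi y) /\
  (forall n (x : 'M[bop K]_n), (forall i j, S (x i j)) ->
    mx_positive x -> mx_positive (map_mx phi x)).

(* M is an injective object for operator systems and completely positive maps:
   every completely positive map from an operator system S to M extends to any
   unital C*-algebra containing S, where it suffices to consider the
   C*-algebras B(K). *)
Definition injective_algebra (R : realType) (H : hilbertType R)
    (M : set (bop H)) :=
  forall (K : hilbertType R) (S : set (bop K)) (phi : bop K -> bop H),
    operator_system S -> completely_positive_on S phi ->
    (forall x, S x -> M (phi x)) ->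
  exists psi : bop K -> bop H,
    [/\ completely_positive_on setT psi, forall x, M (psi x) &
        forall x, S x -> psi x = phi x].

Section crossed_product.
Variables (R : realType) (G : groupType) (H : hilbertType R).
Local Notation C := R[i].

(* Only the restriction of alpha g to M is relevant. Bijectivity of alpha g on
   M follows from the last two clauses. *)
Record star_action (M : set (bop H)) (alpha : G -> bop H -> bop H) : Prop :=
  StarAction {
  act_in : forall g x, M x -> M (alpha g x);
  act_linear : forall g (a : C) x y, M x -> M y ->
    alpha g (a *: x + y) = a *: alpha g x + alpha g y;
  act_mul : forall g x y, M x -> M y -> alpha g (x * y) = alpha g x * alpha g y;
  act_adjoint : forall g x y, M x -> M y -> is_adjoint x y ->
    is_adjoint (alpha g x) (alpha g y);
  act_one : forall x, M x -> alpha 1%g x = x;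
  act_comp : forall g h x, M x -> alpha (g * h)%g x = alpha g (alpha h x) }.

Definition translate (g : G) (f : l2 G H) : G -> H := fun h => f (g^-1 * h)%g.

Lemma translate_sum g (f : l2 G H) (A : {fset G}) :
  \sum_(h <- A) `|translate g f h| ^+ 2 <= l2_dot f f.
Proof.
have := l2_dot_ge f [fset (g^-1 * h)%g | h in A]%fset.
by rewrite big_imfset//= => ? ? _ _; exact: mulgI.
Qed.

Lemma translate_subproof g (f : l2 G H) : translate g f \in @square_summable R G H.
Proof. by apply/asboolP; exists (l2_dot f f) => A; exact: translate_sum. Qed.

Lemma translation_subproof g :
  ((fun f => L2 (translate_subproof g f)) : l2 G H -> l2 G H) \in @bounded_linear R (l2 G H).
Proof.
apply/asboolP; split; first by move=> a u v; exact: val_inj.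
exists 1 => f; rewrite mul1r -(@ler_pXn2r _ 2) ?nnegrE// !l2_normE.
by apply: l2_dot_le => A; exact: translate_sum.
Qed.

(* L_g, the tensor product of the identity of H and of lambda_g. *)
Definition translation (g : G) : bop (l2 G H) := Bop (translation_subproof g).

(* Psi(r) is the diagonal operator with entry alpha_{h^-1}(r) at h. It is
   defined as the bounded operator given by this formula, which exists and is
   unique for every r in M when alpha is an action on M by *-automorphisms. *)
Definition diagonal_rep (alpha : G -> bop H -> bop H) (r : bop H) :
    bop (l2 G H) :=
  xget (0 : bop (l2 G H)) [set T : bop (l2 G H) |
    forall (f : l2 G H) (h : G), T f h = alpha h^-1%g r (f h)].

Definition crossed_product (M : set (bop H)) (alpha : G -> bop H -> bop H) :
    set (bop (l2 G H)) :=
  ultraweak_closure (linear_span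
    [set x | exists g, exists2 r, M r & x = translation g * diagonal_rep alpha r]).

Definition positive_definite (chi : G -> C) :=
  forall n (g : 'I_n -> G) (c : 'I_n -> C),
    0 <= \sum_i \sum_j Num.conj (c i) * c j * chi ((g i)^-1 * g j)%g.

End crossed_product.

Section words.
Variables (G : groupType) (S : {fset G}).

Definition is_word (g : G) (n : nat) :=
  exists w : seq G,
    [/\ size w = n, {subset w <= S} & g = (\prod_(s <- w) s)%g].

Definition generates := forall g, exists n, is_word g n.

Definition word_length (g : G) : nat :=
  xget 0%N [set n | is_word g n /\ forall m, is_word g m -> (n <= m)%N].

End words.

(* (k - 2) / ((k - 1)^(n + 1) - 1) is 1 / (1 + (k - 1) + ... + (k - 1)^n); for
   k = 2 the quotient reads 0 / 0 and stands for its limit 1 / (n + 1). *)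
Definition length_bound (R : realType) (k n : nat) : R :=
  if k == 2 then n.+1%:R^-1
  else (k%:R - 2) / ((k%:R - 1) ^+ n.+1 - 1).

(* Main.v *)
(* Fix a conditional expectation [E] of [B(H)] onto [M] and a nonnegative unit
   vector [xi] of [l2(G)].  With [x_(s,t)] the matrix entries of [x], put
     sigma(x) = sum_(s,t) xi_s xi_t L_s Psi(E(x_(s,t))) L_t^-1.
   Complete positivity of [alpha_h o E] bounds the part of the sum over [A * B]
   in norm by [|xi|_A| |xi|_B| |x|], so that the finite partial sums, which lie
   in the span of the [L_g Psi(r)], converge in norm.  The covariance relation
   [L_g Psi(r) = Psi(alpha_g(r)) L_g] and the bimodule property of [E] give the
   algebraic claims, with [chi(g) = sum_t xi_(gt) xi_t].
   For the lower bound take [xi] proportional to [a(l(g))].  Along a geodesic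
   from [e] to [g] with [n = l(g)] there are points [t_0, ..., t_n] with
   [l(g t_i) = i] and [l(t_i) = n - i], hence
   [chi(g) >= (sum_(i <= n) a_i a_(n-i)) / c] as soon as
   [a_0^2 + sum_(n >= 1) k (k-1)^(n-1) a_n^2 <= c], because the sphere of radius
   [n >= 1] has at most [k (k-1)^(n-1)] points.  Suitable weights are
   [a_n = (k-1)^-n] for [k >= 3]; [a_0 = 2] and [a_n = 1/n] for [k = 2]; and
   [a_n = 1] for [k <= 1]. *)
Require Import Defs.
From mathcomp Require Import all_boot all_order all_algebra finmap.
From mathcomp Require Import all_classical reals topology normedtype.
From mathcomp Require Import complex.
From mathcomp Require Import sesquilinear summability sequences ring lra zify.

Set Implicit Arguments.
Unset Strict Implicit.
Unset Printing Implicit Defensive.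

Import Order.TTheory GRing.Theory Num.Theory.
Import numFieldNormedType.Exports.

Local Open Scope classical_set_scope.
Local Open Scope ring_scope.
Local Open Scope complex_scope.

(* Each [alpha g] is a star-automorphism in a purely algebraic sense and only on [M]. Its
   boundedness, on which the existence of [Psi(r)] rests, and the positivity of its amplifications
   to matrices must be derived. Both follow once a positive matrix over [M], shifted by [e > 0], has
   a square root with entries in [M]. Since [M] is given as its own double commutant, the root is
   built as a limit of polynomials: it then commutes with whatever commutes with the matrix. Two
   finite sets index the partial sums because the difference of two square sums is a union of two
   rectangles. Complete positivity speaks of an off-diagonal rectangle once [x] is placed in the
   corner of the positive matrix with rows [(c, x)] and [(x', c)], where [x'] is the adjoint of [x]
   and [c] bounds its norm. At the identity the claimed bound is [1], and it is attained because
   [xi] is a unit vector. The inequality between weights and [c] is therefore asked for lengths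
   [n >= 1] only; at [n = 0] it would read [c <= a_0^2], which fails for [k >= 1]. *)
#[local] Existing Instance totally_filter.

(** * Order and Hermitian quadratic forms over the complex numbers *)

Section complex_order.
Variable R : realType.
Local Notation C := R[i].

Lemma ge0_complex_Re (z : C) : 0 <= z -> z = (complex.Re z)%:C.
Proof. by move=> z0; rewrite RRe_real// ger0_real. Qed.

Lemma complex_Re_ge0 (z : C) : 0 <= z -> 0 <= complex.Re z.
Proof. by move=> z0; rewrite -lecR -(ge0_complex_Re z0). Qed.

Lemma add_conj_real (z : C) : z + z^*%R \is Num.real.
Proof. by apply/CrealP; rewrite rmorphD /= conjCK addrC. Qed.

(** The order of [C] compares only numbers with a real difference, so the instance [e = 1] is used
    to see that [a - b] is real; what remains is the epsilon argument in [R]. *)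
Lemma ler_addP_eps (a b c : C) : 0 <= c ->
  (forall e : R, 0 < e -> a <= b + c * e%:C) -> a <= b.
Proof.
move=> c0 h.
have ab : a - b = (complex.Re (a - b))%:C.
  have h1 := h 1 ltr01; rewrite RRe_real//.
  have -> : a - b = (a - (b + c * 1)) + c by rewrite mulr1; ring.
  apply: rpredD; last exact: ger0_real.
  by apply: ler0_real; rewrite subr_le0.
rewrite (ge0_complex_Re c0) in h.
have : complex.Re (a - b) <= 0.
  apply/ler_addgt0Pr => e e0; rewrite add0r.
  have c1 : 0 < complex.Re c + 1.
    by rewrite ltr_wpDl// complex_Re_ge0.
  have /h : 0 < e / (complex.Re c + 1) by rewrite divr_gt0.
  rewrite -lerBlDl ab -rmorphM lecR => /le_trans; apply.
  rewrite mulrCA ger_pMr// ler_pdivrMr// mul1r lerDl//.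
by rewrite -lecR -ab subr_le0.
Qed.

(** Common source of the Cauchy-Schwarz inequalities below: a Hermitian form in two variables
    evaluated at [(1, t)]. Real values force the symmetry of the cross terms, and the minimum over
    [t] gives the determinant condition. With [P = 0] it forces the cross terms to vanish. *)
Lemma quadratic_ge0 (P A B D : C) : 0 <= D ->
  (forall t : C, 0 <= P + t^*%R * A + t * B + `|t| ^+ 2 * D) ->
  B = A^*%R /\ `|A| ^+ 2 <= P * D.
Proof.
move=> D0 h.
have P0 : 0 <= P by have := h 0; rewrite rmorph0 normr0 expr0n !mul0r !addr0.
have w t : t^*%R * (A - B^*%R) = t * (A^*%R - B).
  have /ger0_real/CrealP := h t.
  rewrite !rmorphD !rmorphM /= conjCK (geC0_conj P0) (geC0_conj D0).
  rewrite (geC0_conj (normr_ge0 t)) => /addIr e.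
  have -> : t^*%R * (A - B^*%R) = t^*%R * A - t^*%R * B^*%R by ring.
  move: e; rewrite -!addrA => /addrI e.
  by rewrite mulrBr -[t * A^*%R](addrK (t^*%R * B^*%R)) e; ring.
(* With [X = conj A - B], the value [t = 1] gives [A - conj B = X], and then [t = i] gives
   [- i X = i X]. *)
have BA : B = A^*%R.
  have := w 1; rewrite rmorph1 !mul1r => w1.
  have := w (Num.imaginary); rewrite conjCi w1 mulNr => /eqP.
  rewrite eq_sym -addr_eq0 -mulr2n mulrn_eq0 /= mulf_eq0 (negbTE (neq0Ci _)) /=.
  by rewrite subr_eq0 => /eqP.
split=> //; subst B.
have hc (c : C) : 0 <= c -> 0 <= P - 2%:R * c * `|A| ^+ 2 + c ^+ 2 * `|A| ^+ 2 * D.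
  move=> c0; have := h (- c * A); rewrite !rmorphM rmorphN /= (geC0_conj c0).
  rewrite normrM normrN (ger0_norm c0).
  by congr (_ <= _); rewrite exprMn normCK; ring.
have [A0|A0] := eqVneq A 0; first by rewrite A0 normr0 expr0n /= mulr_ge0.
have An : 0 < `|A| ^+ 2 by rewrite exprn_gt0// normr_gt0.
have [D00|Dn0] := eqVneq D 0.
  (* Without a quadratic term the form is unbounded below; this [c] makes its value [-1]. *)
  have c0 : 0 <= (P + 1) / (2%:R * `|A| ^+ 2).
    by rewrite divr_ge0 ?addr_ge0 ?mulr_ge0 ?(ltW An).
  have := hc _ c0; rewrite D00 mulr0 addr0.
  have -> : P - 2%:R * ((P + 1) / (2%:R * `|A| ^+ 2)) * `|A| ^+ 2 = - 1.
    by move: (`|A| ^+ 2) (lt0r_neq0 An) => n n0; field; rewrite n0.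
  by rewrite oppr_ge0 => /(lt_le_trans ltr01); rewrite ltxx.
have Dp : 0 < D by rewrite lt_def Dn0.
(* [c = 1 / D] is the minimizer. *)
have := hc D^-1; rewrite invr_ge0 => /(_ D0).
have -> : P - 2%:R * D^-1 * `|A| ^+ 2 + D^-1 ^+ 2 * `|A| ^+ 2 * D =
  D^-1 * (P * D - `|A| ^+ 2) by field.
by rewrite pmulr_rge0 ?invr_gt0// subr_ge0.
Qed.

End complex_order.

(** * Bounded operators, Riesz representation and adjoints *)

Section hilbert.
Variables (R : realType) (H : hilbertType R).
Local Notation C := R[i].
Implicit Types (u v w : H) (x y : bop H).

Lemma dotC u v : dot u v = (dot v u)^*%R.
Proof. by rewrite hermC expr0 mul1r. Qed.

Lemma dotDl u v w : dot (u + v) w = dot u w + dot v w.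
Proof. exact: linearDl. Qed.
Lemma dotDr u v w : dot u (v + w) = dot u v + dot u w.
Proof. exact: linearDr. Qed.
Lemma dotBl u v w : dot (u - v) w = dot u w - dot v w.
Proof. exact: linearBl. Qed.
Lemma dotBr u v w : dot u (v - w) = dot u v - dot u w.
Proof. exact: linearBr. Qed.
Lemma dotNl u v : dot (- u) v = - dot u v.
Proof. exact: linearNl. Qed.
Lemma dotNr u v : dot u (- v) = - dot u v.
Proof. exact: linearNr. Qed.
Lemma dot0l v : dot 0 v = 0.
Proof. exact: linear0l. Qed.
Lemma dot0r u : dot u 0 = 0.
Proof. exact: linear0r. Qed.
Lemma dotZl a u v : dot (a *: u) v = a * dot u v.
Proof. exact: linearZl_LR. Qed.
Lemma dotZr a u v : dot u (a *: v) = a^*%R * dot u v.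
Proof. exact: linearZr_LR. Qed.
Lemma dot_suml (I : Type) (r : seq I) (P : pred I) (f : I -> H) v :
  dot (\sum_(i <- r | P i) f i) v = \sum_(i <- r | P i) dot (f i) v.
Proof. exact: linear_sumlz. Qed.
Lemma dot_sumr (I : Type) (r : seq I) (P : pred I) (f : I -> H) u :
  dot u (\sum_(i <- r | P i) f i) = \sum_(i <- r | P i) dot u (f i).
Proof. exact: linear_sumr. Qed.

Lemma dot_ge0 u : 0 <= dot u u.
Proof. by rewrite dot_norm exprn_ge0. Qed.

Lemma dot_CS u v : `|dot u v| <= `|u| * `|v|.
Proof.
rewrite -(@ler_pXn2r _ 2) ?nnegrE ?mulr_ge0// exprMn -!dot_norm.
exact: dot_CauchySchwarz.
Qed.

Lemma dot_inj u v : (forall w, dot u w = dot v w) -> u = v.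
Proof.
move=> e; apply/eqP; rewrite -subr_eq0 -normr_eq0 -[_ == 0]sqrf_eq0 -dot_norm.
by rewrite dotBl e subrr.
Qed.

Lemma bopD x u v : x (u + v) = x u + x v.
Proof. by have [xl _] := bopP x; have := xl 1 u v; rewrite !scale1r. Qed.
Lemma bop0 x : x 0 = 0.
Proof. by apply: (@addrI _ (x 0)); rewrite -bopD !addr0. Qed.
Lemma bopZ x a u : x (a *: u) = a *: x u.
Proof. by have [xl _] := bopP x; have := xl a u 0; rewrite !addr0 bop0 addr0. Qed.
Lemma bopN x u : x (- u) = - x u.
Proof. by rewrite -scaleN1r bopZ scaleN1r. Qed.
Lemma bopB x u v : x (u - v) = x u - x v.
Proof. by rewrite bopD bopN. Qed.
Lemma bop_sum x (I : Type) (r : seq I) (P : pred I) (f : I -> H) :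
  x (\sum_(i <- r | P i) f i) = \sum_(i <- r | P i) x (f i).
Proof.
by elim/big_ind2: _ => [|? ? ? ? <- <-|//]; [rewrite bop0|rewrite bopD].
Qed.

Lemma bop_addE x y u : (x + y) u = x u + y u. Proof. by []. Qed.
Lemma bop_subE x y u : (x - y) u = x u - y u. Proof. by []. Qed.
Lemma bop_oppE x u : (- x) u = - x u. Proof. by []. Qed.
Lemma bop_mulE x y u : (x * y) u = x (y u). Proof. by []. Qed.
Lemma bop_scaleE a x u : (a *: x) u = a *: x u. Proof. by []. Qed.
Lemma bop_zeroE u : (0 : bop H) u = 0. Proof. by []. Qed.
Lemma bop_oneE u : (1 : bop H) u = u. Proof. by []. Qed.
Lemma bop_sumE (I : Type) (r : seq I) (P : pred I) (f : I -> bop H) u :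
  (\sum_(i <- r | P i) f i) u = \sum_(i <- r | P i) f i u.
Proof. by elim/big_ind2: _ => // ? ? ? ? <- <-. Qed.

Definition bopE := (bop_addE, bop_subE, bop_oppE, bop_mulE, bop_scaleE,
  bop_zeroE, bop_oneE, bop_sumE).

Lemma bop_eqP x y : (forall u, x u = y u) -> x = y.
Proof. by move=> e; apply/val_inj/funext. Qed.

Lemma bop_scale_mull a x y : (a *: x) * y = a *: (x * y).
Proof. exact: bop_eqP. Qed.
Lemma bop_scale_mulr a x y : x * (a *: y) = a *: (x * y).
Proof. by apply: bop_eqP => u; rewrite !bopE bopZ. Qed.

Lemma bop_bound x : exists2 c : R, 0 <= c & forall u, `|x u| <= c%:C * `|u|.
Proof.
have [_ [M xM]] := bopP x; exists (complex.Re `|M|).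
  exact: complex_Re_ge0.
by move=> u; rewrite -ge0_complex_Re.
Qed.

Lemma exists_bop (f : H -> H) (M : C) :
  (forall a u v, f (a *: u + v) = a *: f u + f v) ->
  (forall u, `|f u| <= M * `|u|) -> exists x : bop H, x =1 f.
Proof.
move=> fl fM; have fb : f \in @bounded_linear R H.
  by apply/asboolP; split=> //; exists M.
by exists (Bop fb).
Qed.

Lemma is_adjoint_sym x y : is_adjoint x y -> is_adjoint y x.
Proof. by move=> h u v; rewrite dotC -h -dotC. Qed.

Lemma is_adjoint_inj x y z : is_adjoint x y -> is_adjoint x z -> y = z.
Proof.
move=> h1 h2; apply: bop_eqP => u; apply: dot_inj => v.
by rewrite dotC -h1 h2 -dotC.
Qed.

Lemma is_adjoint1 : is_adjoint (1 : bop H) 1.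
Proof. by []. Qed.

Lemma is_adjointM x y x' y' : is_adjoint x x' -> is_adjoint y y' ->
  is_adjoint (x * y) (y' * x').
Proof. by move=> hx hy u v; rewrite !bopE hx hy. Qed.

Lemma is_adjointD x y x' y' : is_adjoint x x' -> is_adjoint y y' ->
  is_adjoint (x + y) (x' + y').
Proof. by move=> hx hy u v; rewrite !bopE dotDl dotDr hx hy. Qed.

Lemma is_adjointZ a x x' : is_adjoint x x' -> is_adjoint (a *: x) (a^*%R *: x').
Proof. by move=> hx u v; rewrite !bopE dotZl dotZr conjCK hx. Qed.

Lemma is_adjointB x y x' y' : is_adjoint x x' -> is_adjoint y y' ->
  is_adjoint (x - y) (x' - y').
Proof. by move=> hx hy u v; rewrite !bopE dotBl dotBr hx hy. Qed.

(* The representing vector is the limit of the minimizing filter of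
   [|u|^2 - 2 Re (phi u)], which is Cauchy by the parallelogram identity. *)
Lemma riesz (phi : H -> C) (M : R) :
  (forall a u v, phi (a *: u + v) = a * phi u + phi v) ->
  (forall u, `|phi u| <= M%:C * `|u|) ->
  exists w, forall u, phi u = dot u w.
Proof.
move=> phil phiM.
have phiD u v : phi (u + v) = phi u + phi v.
  by have := phil 1 u v; rewrite scale1r mul1r.
have phi0 : phi 0 = 0 by apply: (@addrI _ (phi 0)); rewrite -phiD !addr0.
have phiZ a u : phi (a *: u) = a * phi u.
  by have := phil a u 0; rewrite addr0 phi0 addr0.
pose Jc u : C := dot u u - (phi u + (phi u)^*%R).
pose J u : R := complex.Re (Jc u).
have JcE u : Jc u = (J u)%:C.
  rewrite /J RRe_real//; apply: rpredB; last exact: add_conj_real.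
  by rewrite ger0_real ?dot_ge0.
have Jlb u : - (M ^+ 2) <= J u.
  pose n := complex.Re `|u|; pose p := complex.Re `|phi u|.
  have nE : `|u| = n%:C by exact: ge0_complex_Re.
  have pE : `|phi u| = p%:C by exact: ge0_complex_Re.
  have pn : p <= M * n.
    by have := phiM u; rewrite nE pE -rmorphM lecR.
  have Jn : n ^+ 2 - 2 * p <= J u.
    rewrite -lecR -JcE /Jc dot_norm nE rmorphB rmorphXn lerD2l lerN2.
    apply: le_trans (_ : `|phi u| + `|phi u| <= _); last first.
      by rewrite pE -rmorphD lecR mulrDl mul1r.
    rewrite -[X in _ <= _ + X]norm_conjC; apply: le_trans (ler_normD _ _).
    by rewrite real_ler_norm// add_conj_real.
  have := sqr_ge0 (n - M); nra.
have hinf : has_inf (range J).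
  by split; [by exists (J 0); exists 0|exists (- (M ^+ 2)) => _ [u _ <-]; exact: Jlb].
pose d := inf (range J).
have dJ u : d <= J u by apply: ge_inf; [case: hinf|exists u].
pose F : set_system H := filter_from [set e : R | 0 < e] (fun e => [set u | J u < d + e]).
have FF : ProperFilter F.
  apply: filter_from_proper.
    apply: filter_from_filter; first by exists 1 => /=.
    move=> e1 e2 /= e10 e20; exists (Num.min e1 e2); first by rewrite /= lt_min e10.
    move=> u /= h; split; apply: lt_le_trans h _; rewrite lerD2l.
      by rewrite ge_min lexx.
    by rewrite ge_min lexx orbT.
  move=> e /= e0; have [_ [u _ <-] ue] := @inf_adherent _ _ _ e0 hinf.
  by exists u.
have par u v : Jc u + Jc v = 2%:R * Jc (2%:R^-1 *: (u + v)) + 2%:R^-1 * `|u - v| ^+ 2.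
  rewrite /Jc phiZ phiD -dot_norm !(dotDl, dotBl, dotDr, dotBr, dotZl, dotZr, dotNl, dotNr).
  rewrite !(rmorphD, rmorphM) /= fmorphV /= rmorph_nat; by field.
have Fc : cvg F.
  apply: cauchy_cvg; apply: cauchy_exP => e e0.
  have [er eE] : exists er : R, e = er%:C.
    by exists (complex.Re e); rewrite RRe_real // gtr0_real.
  have er0 : 0 < er by rewrite -ltcR -eE.
  have d0 : 0 < er ^+ 2 / 4 by rewrite divr_gt0// exprn_gt0.
  have [_ [u _ <-] ue] := inf_adherent d0 hinf.
  exists u; exists (er ^+ 2 / 4) => // v /= ve.
  rewrite -ball_normE /= eE.
  have nE : `|u - v| = (complex.Re `|u - v|)%:C by exact: ge0_complex_Re.
  have := par u v; rewrite !JcE nE.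
  rewrite -[2%:R in X in _ = X]/(2%:R : C) => pe.
  have : J u + J v = 2 * J (2%:R^-1 *: (u + v)) + 2^-1 * (complex.Re `|u - v|) ^+ 2.
    apply: (@complexI R); rewrite !(rmorphD, rmorphM, rmorphXn) /= pe.
    by rewrite fmorphV !rmorph_nat.
  have := dJ (2%:R^-1 *: (u + v)); rewrite -/d in ue; rewrite ltcR => h1 h2.
  rewrite -(@ltr_pXn2r _ 2) ?nnegrE ?(ltW er0) ?complex_Re_ge0//.
  by nra.
have /cvg_ex[/= w0 Fw] := Fc.
exists w0 => u.
(* Variation at the minimizer: for [v] close to [w0] with [J v < d + e] one has
   [J v <= J (v + w) + e], and replacing [v] by [w0] in the cross terms costs at most [2 |w| e]. *)
have key w : 0 <= dot w w + (dot w w0 - phi w) + (dot w w0 - phi w)^*%R.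
  apply: (@ler_addP_eps _ _ _ (1 + 2%:R * `|w|)); first by rewrite addr_ge0// mulr_ge0.
  move=> e e0.
  have e0' : 0 < e%:C by rewrite ltcR.
  have Fe : F [set v | J v < d + e] by exists e.
  have Fe' : F (ball w0 e%:C) by apply: Fw; exact: nbhsx_ballx.
  have [v [/= Jv]] := filter_ex (filterI Fe Fe'); rewrite -ball_normE /= => vw.
  have : Jc v - e%:C <= Jc (v + w).
    by rewrite !JcE -rmorphB lecR; apply: le_trans (dJ _); rewrite lerBlDr ltW.
  rewrite /Jc phiD !(dotDl, dotDr) rmorphD /=.
  rewrite -subr_ge0 => /le_trans; apply.
  have -> : dot v v + dot v w + (dot w v + dot w w) -
      (phi v + phi w + ((phi v)^*%R + (phi w)^*%R)) -
      (dot v v - (phi v + (phi v)^*%R) - e%:C) =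
      dot w w + (dot w w0 - phi w) + (dot w w0 - phi w)^*%R + e%:C +
      (dot w (v - w0) + (dot w (v - w0))^*%R).
    by rewrite dotBr !rmorphB /= (dotC v w); ring.
  rewrite mulrDl mul1r [leRHS]addrA lerD2l.
  apply: le_trans (_ : `|dot w (v - w0)| + `|dot w (v - w0)| <= _).
    rewrite -[X in _ <= _ + X]norm_conjC; apply: le_trans (ler_normD _ _).
    by rewrite real_ler_norm// add_conj_real.
  have -> : 2%:R * `|w| * e%:C = `|w| * e%:C + `|w| * e%:C by ring.
  have : `|dot w (v - w0)| <= `|w| * e%:C.
    by apply: (le_trans (dot_CS _ _)); rewrite ler_wpM2l// distrC ltW.
  by move=> h; rewrite lerD.
(* Applied to [w = t u], the variation is a form in [t] without constant term, so its linear
   coefficient vanishes. *)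
have [|_] := @quadratic_ge0 _ 0 (dot u w0 - phi u)^*%R (dot u w0 - phi u) _ (dot_ge0 u).
  move=> t; have := key (t *: u); rewrite phiZ !dotZl dotZr -mulrBr rmorphM /=.
  by congr (_ <= _); rewrite normCK; ring.
rewrite mul0r norm_conjC => h.
have : `|dot u w0 - phi u| ^+ 2 == 0 by rewrite eq_le h exprn_ge0.
by rewrite sqrf_eq0 normr_eq0 subr_eq0 => /eqP.
Qed.

Lemma exists_adjoint x : exists y, is_adjoint x y.
Proof.
have [c c0 xc] := bop_bound x.
have rz v : exists w, forall u, dot (x u) v = dot u w.
  apply: (@riesz (fun u => dot (x u) v) (c * complex.Re `|v|)).
    by move=> a u w; rewrite bopD bopZ dotDl dotZl.
  move=> u; rewrite rmorphM /= -ge0_complex_Re//.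
  by apply: (le_trans (dot_CS _ _)); rewrite mulrAC ler_wpM2r.
have [f fP] := choice rz.
have [||y yf] := @exists_bop f c%:C.
- move=> a v w; apply: dot_inj => u; rewrite dotC [RHS]dotC -fP; congr (_^*%R).
  by rewrite !dotDr !dotZr !fP.
- move=> v; have [->|f0] := eqVneq (f v) 0; first by rewrite normr0 mulr_ge0// lecR.
  have fp : 0 < `|f v| by rewrite normr_gt0.
  rewrite -(ler_pM2l fp) -expr2 -dot_norm -fP.
  rewrite -[dot _ _]ger0_norm; last by rewrite fP dot_ge0.
  apply: (le_trans (dot_CS _ _)); rewrite mulrCA mulrA ler_wpM2r//.
by exists y => u v; rewrite yf.
Qed.

End hilbert.

(** * Limits of vectors and of operators *)

Section limits.
Variables (R : realType) (H : hilbertType R).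
Local Notation C := R[i].
Implicit Types (u v w : H) (x y : bop H).

Lemma cvg_bop x (T : Type) (F : set_system T) {FF : ProperFilter F}
    (f : T -> H) (a : H) : f @ F --> a -> x (f k) @[k --> F] --> x a.
Proof.
move=> fa; have [c c0 xc] := bop_bound x.
apply/cvgrPdist_lt => e e0.
have c1 : 0 < (c + 1)%:C :> C by rewrite ltcR ltr_wpDl.
have /cvgrPdist_lt /(_ (e / (c + 1)%:C)) := fa.
rewrite divr_gt0// => /(_ isT); apply: filterS => k h.
rewrite -bopB; apply: le_lt_trans (xc _) _.
apply: le_lt_trans (_ : _ <= (c + 1)%:C * `|a - f k|) _.
  by rewrite ler_wpM2r// lecR lerDl.
by rewrite mulrC -ltr_pdivlMr.
Qed.

Lemma cvg_dotl (T : Type) (F : set_system T) {FF : ProperFilter F}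
    (f : T -> H) (a : H) : f @ F --> a -> forall v,
  (dot (f k) v : C^o) @[k --> F] --> (dot a v : C^o).
Proof.
move=> fa v; apply/cvgrPdist_lt => e e0.
have v1 : 0 < `|v| + 1 by rewrite ltr_wpDl.
have /cvgrPdist_lt /(_ (e / (`|v| + 1))) := fa.
rewrite divr_gt0// => /(_ isT); apply: filterS => k h.
rewrite -dotBl; apply: le_lt_trans (dot_CS _ _) _.
apply: le_lt_trans (_ : _ <= `|a - f k| * (`|v| + 1)) _.
  by rewrite ler_wpM2l// lerDl.
by rewrite -ltr_pdivlMr.
Qed.

Lemma cvg_dotr (T : Type) (F : set_system T) {FF : ProperFilter F}
    (f : T -> H) (a : H) : f @ F --> a -> forall v,
  (dot v (f k) : C^o) @[k --> F] --> (dot v a : C^o).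
Proof.
move=> fa v; have /cvgrPdist_lt h : (dot (f k) v : C^o) @[k --> F] --> (dot a v : C^o).
  exact: cvg_dotl.
apply/cvgrPdist_lt => e /h; apply: filterS => k.
by rewrite [dot v a]dotC [dot v (f k)]dotC -rmorphB norm_conjC.
Qed.

Lemma cvg_norm_le (T : Type) (F : set_system T) {FF : ProperFilter F}
    (f : T -> H) (a : H) (c : C) :
  f @ F --> a -> (\forall k \near F, `|f k| <= c) -> `|a| <= c.
Proof.
move=> fa fc; apply: (cvgC_le FF (cvg_norm fa)) => //.
Qed.

Lemma bop_lim (T : Type) (F : set_system T) {FF : ProperFilter F}
    (Y : T -> bop H) (c : R) :
  (forall k u, `|Y k u| <= c%:C * `|u|) ->
  (forall u, cvg (Y k u @[k --> F])) ->
  exists Z : bop H, forall u, Y k u @[k --> F] --> Z u.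
Proof.
move=> Yc Yl.
have [||Z ZE] := @exists_bop _ _ (fun u => lim (Y k u @[k --> F])) c%:C.
- move=> a u v; apply: (cvg_lim (@norm_hausdorff _ _)).
  under eq_fun do rewrite bopD bopZ.
  by apply: cvgD; [apply: cvgZl_tmp|]; exact: Yl.
- by move=> u; apply: (cvg_norm_le (Yl u)); exact: nearW.
by exists Z => u; rewrite ZE; exact: Yl.
Qed.

Lemma cvg_geometric_hilbert (f : nat -> H) (M s : R) : 0 <= s < 1 ->
  (forall k, `|f k.+1 - f k| <= (M * s ^+ k)%:C) -> cvg (f @ \oo).
Proof.
move=> /andP[s0 s1] h.
have M0 : 0 <= M.
  by have := le_trans (normr_ge0 _) (h 0%N); rewrite expr0 mulr1 (_ : 0 = 0%:C)// lecR.
have s1' : 0 < 1 - s by rewrite subr_gt0.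
have tail k p : `|f (k + p)%N - f k| <= (M * (s ^+ k / (1 - s) - s ^+ (k + p) / (1 - s)))%:C.
  elim: p => [|p IH]; first by rewrite addn0 !subrr normr0 mulr0.
  have -> : f (k + p.+1)%N - f k = (f (k + p).+1 - f (k + p)%N) + (f (k + p)%N - f k).
    by rewrite addnS addrA subrK.
  apply: (le_trans (ler_normD _ _)); apply: le_trans (lerD (h _) IH) _.
  rewrite -rmorphD lecR addnS exprS le_eqVlt; apply/orP; left; apply/eqP.
  by field; rewrite lt0r_neq0.
apply: cauchy_cvg; apply: cauchy_exP => e e0.
have [er eE] : exists er : R, e = er%:C.
  by exists (complex.Re e); rewrite RRe_real // gtr0_real.
have er0 : 0 < er by rewrite -ltcR -eE.
have sc : (fun k => M / (1 - s) * s ^+ k) @ \oo --> (0 : R).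
  rewrite -[X in _ --> X](mulr0 (M / (1 - s))).
  by apply: cvgMr; apply: cvg_expr; rewrite ger0_norm.
have /cvgrPdist_lt /(_ _ er0) [N _ Nh] := sc.
exists (f N); exists N => // k /= Nk.
rewrite -ball_normE /= distrC eE -(subnKC Nk).
apply: le_lt_trans (tail _ _) _; rewrite ltcR.
have /= := Nh N (leqnn N); rewrite sub0r normrN => /(le_lt_trans (ler_norm _)).
apply: le_lt_trans; rewrite mulrBr mulrAC mulrA lerBlDr lerDl.
by rewrite mulr_ge0// divr_ge0 ?exprn_ge0// ltW.
Qed.

End limits.

(** * Square roots of positive operators *)

Section square_root.
Variables (R : realType) (H : hilbertType R).
Local Notation C := R[i].
Implicit Types (u v w : H) (T A : bop H).

(** Positivity at [u + t v] for all complex [t] is the quadratic form of [quadratic_ge0]; its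
    symmetry is self-adjointness. *)
Lemma bop_ge0_CS T : (forall u, 0 <= dot (T u) u) ->
  is_adjoint T T /\
  forall u v, `|dot (T u) v| ^+ 2 <= dot (T u) u * dot (T v) v.
Proof.
move=> T0.
have q u v : dot (T v) u = (dot (T u) v)^*%R /\
    `|dot (T u) v| ^+ 2 <= dot (T u) u * dot (T v) v.
  apply: quadratic_ge0 => // t; have := T0 (u + t *: v).
  rewrite bopD bopZ !(dotDl, dotDr, dotZl, dotZr).
  by congr (_ <= _); rewrite normCK; ring.
by split=> u v; [rewrite (q v u).1 -dotC|exact: (q u v).2].
Qed.

(** Cauchy-Schwarz for the form of [T] at the pair [u], [T u] bounds [|T u|^4] by [r |u|^2] times
    [r |T u|^2]. *)
Lemma bop_ge0_norm T (r : R) : (forall u, 0 <= dot (T u) u) ->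
  (forall u, dot (T u) u <= r%:C * `|u| ^+ 2) ->
  forall u, `|T u| <= r%:C * `|u|.
Proof.
move=> T0 Tr u; have [_ CS] := bop_ge0_CS T0.
have [->|u0] := eqVneq u 0; first by rewrite bop0 normr0 mulr0.
have r0 : 0 <= r%:C :> C.
  by rewrite -(@pmulr_lge0 _ (`|u| ^+ 2)) ?(le_trans (T0 u))// exprn_gt0 ?normr_gt0.
have [->|Tu0] := eqVneq (T u) 0; first by rewrite normr0 mulr_ge0.
have Tp : 0 < `|T u| ^+ 2 by rewrite exprn_gt0// normr_gt0.
rewrite -(@ler_pXn2r _ 2) ?nnegrE ?mulr_ge0// -(ler_pM2r Tp).
have := CS u (T u); rewrite dot_norm normrX normr_id => h.
rewrite -expr2 (le_trans h)// exprMn.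
have -> : r%:C ^+ 2 * `|u| ^+ 2 * `|T u| ^+ 2 = (r%:C * `|u| ^+ 2) * (r%:C * `|T u| ^+ 2) by ring.
by rewrite ler_pM.
Qed.

(* [1 - Z] is the square root of [1 - T]: [Z] is the norm limit of the
   iteration [Z := (T + Z^2) / 2], a contraction on the ball of radius [s]. *)
Lemma sqrt_one_sub T (s : R) : 0 <= s < 1 -> (forall u, 0 <= dot (T u) u) ->
  (forall u, dot (T u) u <= (2 * s - s ^+ 2)%:C * `|u| ^+ 2) ->
  exists Z : bop H, [/\ is_adjoint Z Z, (1 - Z) * (1 - Z) = 1 - T &
    forall X, X * T = T * X -> X * Z = Z * X].
Proof.
move=> s01 T0 Ts; have /andP[s0 s1] := s01.
have Tn := bop_ge0_norm T0 Ts; have [Ta _] := bop_ge0_CS T0.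
have s0C : 0 <= s%:C :> C by rewrite lecR.
have h2 : `|2%:R^-1 : C| = 2%:R^-1 by rewrite normfV normr_nat.
pose Y := fix Y k : bop H := if k is k'.+1 then 2%:R^-1 *: (T + Y k' * Y k') else 0.
(* Every iterate is a polynomial in [T]. *)
have YT X : X * T = T * X -> forall k, X * Y k = Y k * X.
  move=> XT; elim=> [|k IH]; first by rewrite mulr0 mul0r.
  rewrite /= bop_scale_mulr bop_scale_mull mulrDr mulrDl XT; congr (_ *: (_ + _)).
  by rewrite mulrA IH -mulrA IH mulrA.
have YY k j : Y k * Y j = Y j * Y k by rewrite (YT (Y k))// YT.
have Yadj k : is_adjoint (Y k) (Y k).
  elim: k => [|k IH]; first by move=> u v; rewrite !bopE dot0l dot0r.
  have := is_adjointZ 2%:R^-1 (is_adjointD Ta (is_adjointM IH IH)).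
  by rewrite fmorphV /= rmorph_nat.
(* [s] is a fixed point of the scalar iteration [z := ((2 s - s^2) + z^2) / 2], so the ball of
   radius [s] is preserved. *)
have Yn k u : `|Y k u| <= s%:C * `|u|.
  elim: k u => [|k IH] u; first by rewrite !bopE normr0 mulr_ge0.
  rewrite !bopE normrZ h2 ler_pdivrMl//.
  apply: (le_trans (ler_normD _ _)).
  have YYu : `|Y k (Y k u)| <= (s ^+ 2)%:C * `|u|.
    apply: (le_trans (IH _)); rewrite expr2 rmorphM /= -mulrA.
    by rewrite ler_wpM2l.
  apply: (le_trans (lerD (Tn u) YYu)); rewrite -mulrDl -rmorphD.
  by rewrite subrK mulrA rmorphM /= rmorph_nat.
(* Since the iterates commute, [Y_(k+2) - Y_(k+1)] is half of [Y_(k+1) + Y_k] applied to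
   [Y_(k+1) - Y_k], and that half-sum has norm at most [s]. *)
have Yd k u : `|Y k.+1 u - Y k u| <= (s ^+ k)%:C * `|u|.
  elim: k u => [|k IH] u.
    rewrite [Y 0 u]/(0 : H) subr0 (le_trans (Yn 1%N u))// ler_wpM2r// lecR expr0.
    exact: ltW.
  have -> : Y k.+2 u - Y k.+1 u =
      2%:R^-1 *: (Y k.+1 (Y k.+1 u - Y k u) + Y k (Y k.+1 u - Y k u)).
    rewrite [Y k.+2 u]/(2%:R^-1 *: (T u + Y k.+1 (Y k.+1 u))).
    rewrite [X in _ - X]/(2%:R^-1 *: (T u + Y k (Y k u))) -scalerBr.
    congr (_ *: _); rewrite !bopB -[Y k (Y k.+1 u)]/((Y k * Y k.+1) u) YY bopE.
    by rewrite addrA subrK opprD addrACA subrr add0r.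
  rewrite normrZ h2 ler_pdivrMl//.
  apply: (le_trans (ler_normD _ _)); apply: (le_trans (lerD (Yn _ _) (Yn _ _))).
  have h : s%:C * `|Y k.+1 u - Y k u| <= (s ^+ k.+1)%:C * `|u|.
    by rewrite exprS rmorphM -[leRHS]mulrA ler_wpM2l.
  by rewrite mulr_natl mulr2n lerD.
have [|Z YZ] := bop_lim (F := \oo) Yn.
  move=> u; apply: (@cvg_geometric_hilbert _ _ _ (complex.Re `|u|) s s01) => k.
  by rewrite mulrC rmorphM /= -ge0_complex_Re//; exact: Yd.
have ZE : Z = 2%:R^-1 *: (T + Z * Z).
  apply: bop_eqP => u.
  have YYZ : Y k (Y k u) @[k --> \oo] --> Z (Z u).
    apply/cvgrPdist_lt => e e0.
    have e2 : 0 < e / 2%:R by rewrite divr_gt0.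
    have /cvgrPdist_lt /(_ _ e2) h1 := YZ u.
    have /cvgrPdist_lt /(_ _ e2) h3 := YZ (Z u).
    apply: filterS2 h1 h3 => k h1 h3.
    have -> : Z (Z u) - Y k (Y k u) = Y k (Z u - Y k u) + (Z (Z u) - Y k (Z u)).
      by rewrite bopB [RHS]addrC addrA subrK.
    rewrite (splitr e); apply: le_lt_trans (ler_normD _ _) _; apply: ltr_leD; last exact: ltW.
    apply: le_lt_trans (Yn _ _) _; apply: le_lt_trans h1.
    by rewrite ler_piMl// lecR ltW.
  have l1 : Y k.+1 u @[k --> \oo] --> Z u by have := YZ u; rewrite -(cvg_shiftS (fun k => Y k u)).
  have l2 : Y k.+1 u @[k --> \oo] --> 2%:R^-1 *: (T u + Z (Z u)).
    rewrite /=; apply: cvgZl_tmp; apply: cvgD YYZ; exact: cvg_cst.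
  exact: (cvg_unique _ l1 l2).
exists Z; split.
- move=> u v.
  have l1 : (dot (Y k u) v : C^o) @[k --> \oo] --> (dot (Z u) v : C^o) by exact: cvg_dotl.
  have l2 : (dot u (Y k v) : C^o) @[k --> \oo] --> (dot u (Z v) : C^o) by exact: cvg_dotr.
  have e : (fun k => dot (Y k u) v : C^o) = (fun k => dot u (Y k v)).
    by apply/funext => k; rewrite Yadj.
  by rewrite e in l1; exact: (cvg_unique (@C_hausdorff R) l1 l2).
- have : 2%:R *: Z = T + Z * Z by rewrite {1}ZE scalerA divff ?pnatr_eq0// scale1r.
  rewrite scaler_nat mulrBl mul1r mulrBr mulr1 opprB addrA => e.
  have -> : T = Z *+ 2 - Z * Z by rewrite e addrK.
  by rewrite opprB mulr2n opprD [RHS]addrCA [RHS]addrC !addrA [RHS]addrAC.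
- move=> X XT; apply: bop_eqP => u; rewrite !bopE.
  have l1 : X (Y k u) @[k --> \oo] --> X (Z u) by apply: cvg_bop; exact: YZ.
  have e : (fun k => X (Y k u)) = (fun k => Y k (X u)).
    by apply/funext => k; have := congr1 (fun W : bop H => W u) (YT X XT k).
  by rewrite e in l1; exact: (cvg_unique _ l1 (YZ (X u))).
Qed.

(** Divided by [K = c + e], with [c] a norm bound of [A], the operator [A + e] becomes [1 - T] with
    [T <= 1 - e / K]. The shift by [e] keeps [T] away from [1], where the iteration ceases to
    contract; [s] is the root below [1] of [2 s - s^2 = 1 - e / K]. *)
Lemma sqrt_bop A (e : R) : 0 < e -> (forall u, 0 <= dot (A u) u) ->
  exists B : bop H, [/\ is_adjoint B B, B * B = A + e%:C *: (1 : bop H) &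
    forall X, X * A = A * X -> X * B = B * X].
Proof.
move=> e0 A0; have [c c0 Ac] := bop_bound A.
pose K := c + e; have K0 : 0 < K by rewrite ltr_wpDl.
have eK : 0 <= e / K by rewrite divr_ge0 ?ltW.
pose s := 1 - Num.sqrt (e / K).
have s01 : 0 <= s < 1.
  rewrite subr_ge0 gtrBl sqrtr_gt0 divr_gt0// andbT -sqrtr1 ler_sqrt//.
  by rewrite ler_pdivrMr// mul1r lerDr.
have sE : 2 * s - s ^+ 2 = 1 - e / K.
  by rewrite /s -[in RHS](sqr_sqrtr eK); ring.
have K0C : 0 < K%:C :> C by rewrite ltcR.
pose T : bop H := 1 - K%:C^-1 *: (A + e%:C *: (1 : bop H)).
have TE u : dot (T u) u = `|u| ^+ 2 - K%:C^-1 * (dot (A u) u + e%:C * `|u| ^+ 2).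
  by rewrite !bopE dotBl dotZl dotDl dotZl dot_norm.
have Au u : dot (A u) u <= c%:C * `|u| ^+ 2.
  rewrite -[dot _ _]ger0_norm//; apply: (le_trans (dot_CS _ _)).
  by rewrite expr2 mulrA ler_wpM2r.
have [||Z [Za Z2 ZX]] := @sqrt_one_sub T s s01.
- move=> u; rewrite TE subr_ge0 ler_pdivrMl// rmorphD /= mulrDl lerD2r//.
- move=> u; rewrite TE sE rmorphB rmorphM /= fmorphV /= mulrBl mul1r lerD2l lerN2.
  by rewrite [e%:C / _]mulrC -mulrA ler_pM2l ?invr_gt0// lerDr.
exists ((Num.sqrt K)%:C *: (1 - Z)); split.
- have := is_adjointZ (Num.sqrt K)%:C (is_adjointB (@is_adjoint1 _ H) Za).
  by rewrite geC0_conj// lecR sqrtr_ge0.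
- rewrite bop_scale_mull bop_scale_mulr Z2 scalerA -rmorphM -expr2 sqr_sqrtr ?ltW//.
  by rewrite /T opprB addrC subrK scalerA divff ?lt0r_neq0// scale1r.
- move=> X XA; rewrite bop_scale_mulr bop_scale_mull mulrBr mulrBl mulr1 mul1r ZX//.
  rewrite /T mulrBr mulrBl mulr1 mul1r bop_scale_mulr bop_scale_mull.
  by rewrite mulrDr mulrDl XA bop_scale_mulr bop_scale_mull mulr1 mul1r.
Qed.

End square_root.

(** * Matrix entries of operators on direct sums *)

Section finite_support.
Variables (R : realType) (I : choiceType).
Local Notation C := R[i].

Lemma sum_fin_support (A : {fset I}) (f : I -> C) :
  (forall i, i \notin A -> f i = 0) ->
  sum (f : I -> C^o) = \sum_(i <- A) f i.
Proof.
move=> f0; apply: (@Defs.sum_eq _ _ f (\sum_(i <- A) f i)); apply/cvgrPdist_lt => e e0; exists A => // B /= AB.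
rewrite partial_sumE distrC sum_fsetD// big_seq big1 ?normr0// => i.
by rewrite inE => /andP[/f0].
Qed.

End finite_support.

Lemma sum_finType (R : realType) (I : finType) (f : I -> R[i]) :
  sum (f : I -> R[i]^o) = \sum_i f i.
Proof.
rewrite (@sum_fin_support _ _ [fset x in I]%fset) => [|i]; last by rewrite !inE.
rewrite big_uniq ?fset_uniq//=; apply: eq_bigl => i.
by have : i \in [fset x in I]%fset by rewrite !inE.
Qed.

Section l2_theory.
Variables (R : realType) (I : choiceType) (H : hilbertType R).
Local Notation C := R[i].
Implicit Types (f g : l2 I H) (x y : bop (l2 I H)).

Lemma l2_eqP f g : (forall i, f i = g i) -> f = g.
Proof. by move=> e; apply/val_inj/funext. Qed.

Lemma l2_sumE (J : Type) (r : seq J) (P : pred J) (f : J -> l2 I H) i :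
  (\sum_(j <- r | P j) f j) i = \sum_(j <- r | P j) f j i.
Proof. by elim/big_ind2: _ => // ? ? ? ? <- <-. Qed.

Lemma l2_dotE f g : dot f g = sum ((fun i => dot (f i) (g i)) : I -> C^o).
Proof. by []. Qed.

Lemma l2_coord_le f i : `|f i| <= `|f|.
Proof. by rewrite -(@ler_pXn2r _ 2) ?nnegrE// l2_normE; exact: l2_le. Qed.

Lemma l2_delta_subproof i (u : H) :
  (fun j => if j == i then u else 0) \in @square_summable R I H.
Proof.
apply/asboolP; exists (`|u| ^+ 2) => A.
apply: le_trans (_ : \sum_(j <- (i |` A)%fset) `|if j == i then u else 0| ^+ 2 <= _).
  by rewrite -subr_ge0 sum_fsetD ?fsubsetU1// sumr_ge0// => j _; rewrite exprn_ge0.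
rewrite (bigD1_seq i) ?fset_uniq ?fset1U1//= eqxx big1 ?addr0// => j /negbTE ->.
by rewrite normr0 expr0n.
Qed.

Definition l2_delta i u : l2 I H := L2 (l2_delta_subproof i u).

Lemma l2_deltaE i u j : l2_delta i u j = if j == i then u else 0.
Proof. by []. Qed.

Lemma l2_delta_lin i (a : C) u v :
  l2_delta i (a *: u + v) = a *: l2_delta i u + l2_delta i v.
Proof.
apply: l2_eqP => j; rewrite ?l2_deltaE.
rewrite -[RHS]/(a *: l2_delta i u j + l2_delta i v j) !l2_deltaE.
by case: ifP => // _; rewrite scaler0 addr0.
Qed.

Lemma dot_deltal i u f : dot (l2_delta i u) f = dot u (f i).
Proof.
rewrite l2_dotE (@sum_fin_support _ _ [fset i]%fset) => [|j].
  by rewrite big_seq_fset1 l2_deltaE eqxx.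
by rewrite inE l2_deltaE => /negbTE ->; rewrite dot0l.
Qed.

Lemma dot_deltar i u f : dot f (l2_delta i u) = dot (f i) u.
Proof. by rewrite dotC dot_deltal -dotC. Qed.

Lemma l2_delta_norm i u : `|l2_delta i u| = `|u|.
Proof.
apply/eqP; rewrite -(@eqrXn2 _ 2)// -!dot_norm dot_deltal l2_deltaE eqxx //.
Qed.

Lemma exists_entry x (s t : I) :
  exists y : bop H, forall u, y u = x (l2_delta t u) s.
Proof.
have [c c0 xc] := bop_bound x.
apply: (@exists_bop _ _ (fun u => x (l2_delta t u) s) c%:C) => [a u v|u].
  by rewrite l2_delta_lin bopD bopZ.
apply: (le_trans (l2_coord_le _ _)).
by apply: (le_trans (xc _)); rewrite l2_delta_norm.
Qed.

Definition entry x s t : bop H := sval (cid (exists_entry x s t)).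

Lemma entryE x s t u : entry x s t u = x (l2_delta t u) s.
Proof. by rewrite /entry; case: cid => y /= ->. Qed.

Lemma entry_lin a x y s t :
  entry (a *: x + y) s t = a *: entry x s t + entry y s t.
Proof. by apply: bop_eqP => u; rewrite !bopE !entryE !bopE. Qed.

Lemma dot_entry x s t u v :
  dot (entry x s t u) v = dot (x (l2_delta t u)) (l2_delta s v).
Proof. by rewrite entryE dot_deltar. Qed.

End l2_theory.

Section matrix_operators.
Variables (R : realType) (I : finType) (H : hilbertType R).
Local Notation C := R[i].
Implicit Types (f g : l2 I H) (x y : bop (l2 I H)) (X : I -> I -> bop H).

Lemma l2_finE f : f = \sum_i l2_delta i (f i).
Proof.
apply: l2_eqP => j; rewrite l2_sumE (bigD1 j)//= ?l2_deltaE eqxx big1 ?addr0// => i.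
by rewrite ?l2_deltaE eq_sym => /negbTE ->.
Qed.

(** This turns a finite matrix over [bop H] into a single operator on the direct sum, to which the
    square root applies. *)
Lemma exists_mxop X : exists x : bop (l2 I H),
  forall f i, x f i = \sum_j X i j (f j).
Proof.
have [c c0 cX] : exists2 c : I -> I -> R, (forall i j, 0 <= c i j) &
    forall i j u, `|X i j u| <= (c i j)%:C * `|u|.
  have h p : exists c : R, 0 <= c /\ forall u, `|X p.1 p.2 u| <= c%:C * `|u|.
    by have [c ? ?] := bop_bound (X p.1 p.2); exists c.
  have [c cP] := choice h.
  by exists (fun i j => c (i, j)) => i j; have [] := cP (i, j).
have [||x xE] := @exists_bop _ _
    (fun f : l2 I H => \sum_i \sum_j l2_delta i (X i j (f j))) (\sum_i \sum_j (c i j)%:C).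
- move=> a f g; rewrite scaler_sumr -big_split; apply: eq_bigr => i _ /=.
  rewrite scaler_sumr -big_split; apply: eq_bigr => j _ /=.
  by rewrite -l2_delta_lin -bopZ -bopD.
- move=> f; rewrite mulr_suml; apply: (le_trans (ler_norm_sum _ _ _)).
  apply: ler_sum => i _; rewrite mulr_suml; apply: (le_trans (ler_norm_sum _ _ _)).
  apply: ler_sum => j _; rewrite l2_delta_norm; apply: (le_trans (cX _ _ _)).
  by rewrite ler_wpM2l ?lecR// l2_coord_le.
exists x => f i; rewrite xE l2_sumE (bigD1 i)//= [X in _ + X]big1 ?addr0 => [|k].
  by rewrite l2_sumE; apply: eq_bigr => j _; rewrite ?l2_deltaE eqxx.
rewrite eq_sym => /negbTE ki; rewrite l2_sumE big1// => j _.
by rewrite ?l2_deltaE ki.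
Qed.

Definition mxop X : bop (l2 I H) := sval (cid (exists_mxop X)).

Lemma mxopE X f i : mxop X f i = \sum_j X i j (f j).
Proof. by rewrite /mxop; case: cid => y /= ->. Qed.

Lemma dot_mxop X f g : dot (mxop X f) g = \sum_i \sum_j dot (X i j (f j)) (g i).
Proof.
rewrite l2_dotE sum_finType; apply: eq_bigr => i _.
by rewrite mxopE dot_suml.
Qed.

Lemma bop_entryE x f i : x f i = \sum_j entry x i j (f j).
Proof.
rewrite {1}(l2_finE f) bop_sum l2_sumE; apply: eq_bigr => j _.
by rewrite entryE.
Qed.

Lemma entry_mxop X i j : entry (mxop X) i j = X i j.
Proof.
apply: bop_eqP => u; rewrite entryE mxopE (bigD1 j)//= ?l2_deltaE eqxx big1 ?addr0// => k.
by rewrite ?l2_deltaE => /negbTE ->; rewrite bop0.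
Qed.

End matrix_operators.

(** * Von Neumann algebras as double commutants *)

Section vna_theory.
Variables (R : realType) (H : hilbertType R) (M : set (bop H)).
Hypothesis M_vna : von_neumann_algebra M.
Local Notation C := R[i].
Implicit Types (x y : bop H).

(** The membership criterion from which closure under the algebraic operations is derived. *)
Lemma vnaP x : (forall y, commutant M y -> x * y = y * x) -> M x.
Proof. by case: M_vna => _ {2}<-. Qed.

Lemma vna_comm x y : M x -> commutant M y -> x * y = y * x.
Proof. by move=> Mx My; rewrite My. Qed.

Lemma vna_lin a x y : M x -> M y -> M (a *: x + y).
Proof.
move=> Mx My; apply: vnaP => z zM.
by rewrite mulrDl mulrDr bop_scale_mull bop_scale_mulr !(@vna_comm _ z).
Qed.

Lemma vna0 : M 0.
Proof. by apply: vnaP => z zM; rewrite mul0r mulr0. Qed.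

Lemma vna1 : M 1.
Proof. by apply: vnaP => z zM; rewrite mul1r mulr1. Qed.

Lemma vnaZ a x : M x -> M (a *: x).
Proof. by move=> Mx; rewrite -[_ *: _]addr0; apply: vna_lin => //; exact: vna0. Qed.

Lemma vnaD x y : M x -> M y -> M (x + y).
Proof. by move=> Mx My; rewrite -[x]scale1r; exact: vna_lin. Qed.

Lemma vnaB x y : M x -> M y -> M (x - y).
Proof. by move=> Mx My; rewrite addrC -scaleN1r; exact: vna_lin. Qed.

Lemma vnaM x y : M x -> M y -> M (x * y).
Proof.
move=> Mx My; apply: vnaP => z zM.
by rewrite -mulrA (vna_comm My zM) !mulrA (vna_comm Mx zM).
Qed.

Lemma vna_sum (I : Type) (r : seq I) (P : pred I) (f : I -> bop H) :
  (forall i, P i -> M (f i)) -> M (\sum_(i <- r | P i) f i).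
Proof. by move=> Mf; elim/big_ind: _ => //; [exact: vna0|exact: vnaD]. Qed.

Lemma vna_adjoint x y : M x -> is_adjoint x y -> M y.
Proof.
move=> Mx xy; case: M_vna => Ms _; have [z Mz xz] := Ms x Mx.
by rewrite (is_adjoint_inj xy xz).
Qed.

End vna_theory.

(** * Positivity and boundedness of star-automorphisms *)

Section action_theory.
Variables (R : realType) (G : groupType) (H : hilbertType R) (M : set (bop H)).
Variable alpha : G -> bop H -> bop H.
Hypothesis M_vna : von_neumann_algebra M.
Hypothesis alpha_action : star_action M alpha.
Local Notation C := R[i].
Implicit Types (g h : G) (x y : bop H).

Let vna1 := vna1 M_vna.
Let vna0 := vna0 M_vna.

Lemma act0 g : alpha g 0 = 0.
Proof.
have := act_linear alpha_action g (-1) vna0 vna0.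
by rewrite scaler0 addr0 scaleN1r addNr.
Qed.

Lemma actD g x y : M x -> M y -> alpha g (x + y) = alpha g x + alpha g y.
Proof.
by move=> Mx My; have := act_linear alpha_action g 1 Mx My; rewrite !scale1r.
Qed.

Lemma actZ g a x : M x -> alpha g (a *: x) = a *: alpha g x.
Proof.
move=> Mx; have := act_linear alpha_action g a Mx vna0.
by rewrite act0 !addr0.
Qed.

Lemma actB g x y : M x -> M y -> alpha g (x - y) = alpha g x - alpha g y.
Proof.
move=> Mx My; have := act_linear alpha_action g (-1) My Mx.
by rewrite !scaleN1r ![- _ + _]addrC.
Qed.

Lemma act_sum g (I : Type) (r : seq I) (f : I -> bop H) :
  (forall i, M (f i)) -> alpha g (\sum_(i <- r) f i) = \sum_(i <- r) alpha g (f i).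
Proof.
move=> Mf; elim: r => [|i r IH]; first by rewrite !big_nil act0.
by rewrite !big_cons actD ?IH//; apply: (vna_sum M_vna).
Qed.

(** [alpha g 1] acts as a left unit on the values of [alpha g] on [M], and [1] is such a value. *)
Lemma act_unit g : alpha g 1 = 1.
Proof.
have Mg := act_in alpha_action g^-1%g vna1.
have e : alpha g (alpha g^-1%g 1) = 1.
  by rewrite -(act_comp alpha_action) ?mulgV ?(act_one alpha_action).
by rewrite -[RHS]e -[alpha g^-1%g 1]mul1r (act_mul alpha_action)// e mulr1.
Qed.

Lemma act_invK g x : M x -> alpha g (alpha g^-1%g x) = x.
Proof.
by move=> Mx; rewrite -(act_comp alpha_action)// mulgV (act_one alpha_action).
Qed.

(* A positive matrix over [M] is, up to [e > 0], the square of a self-adjoint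
   matrix over [M], and this is an algebraic identity which [alpha g] preserves. *)
Lemma act_positive g n (X : 'M[bop H]_n) : (forall i j, M (X i j)) ->
  mx_positive X -> mx_positive (map_mx (alpha g) X).
Proof.
move=> MX X0 xi.
have A0 f : 0 <= dot (mxop X f) f by rewrite dot_mxop; exact: X0.
apply: (@ler_addP_eps _ _ _ (\sum_i `|xi i| ^+ 2)).
  by apply: sumr_ge0 => i _; rewrite exprn_ge0.
move=> e e0; have [B [Ba BB BX]] := sqrt_bop e0 A0.
pose b i j := entry B i j.
(* An element of the commutant of [M], repeated along the diagonal, commutes with the matrix [X],
   hence with its root [B]; reading off entries, it commutes with each [b i j]. *)
have bM i j : M (b i j).
  apply: (vnaP M_vna) => y yM.
  pose D := mxop (fun i j : 'I_n => if i == j then y else 0).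
  have DE f k : D f k = y (f k).
    rewrite mxopE (bigD1 k)//= eqxx big1 ?addr0// => l.
    by rewrite eq_sym => /negbTE ->.
  have DB : D * B = B * D.
    apply: BX; apply: bop_eqP => f; apply: l2_eqP => k.
    rewrite !bopE DE !mxopE bop_sum; apply: eq_bigr => l _.
    rewrite DE; have := vna_comm (MX k l) yM.
    by move=> /(congr1 (fun z : bop H => z (f l))).
  apply: bop_eqP => u; rewrite !bopE !entryE.
  have -> : l2_delta j (y u) = D (l2_delta j u).
    apply: l2_eqP => k; rewrite DE !l2_deltaE.
    by case: ifP => // _; rewrite bop0.
  by rewrite -[B (D _)]/((B * D) _) -DB bopE DE.
have ba i j : is_adjoint (b i j) (b j i).
  by move=> u v; rewrite dot_entry Ba dotC -dot_entry -dotC.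
have bb i j : X i j + (if i == j then e%:C *: (1 : bop H) else 0) =
    \sum_k b i k * b k j.
  apply: bop_eqP => u; rewrite bopE bop_sumE.
  transitivity ((B * B) (l2_delta j u) i).
    rewrite BB -[RHS]/(mxop X (l2_delta j u) i + e%:C *: (l2_delta j u i)).
    rewrite -entryE entry_mxop l2_deltaE; congr (_ + _).
    by case: ifP => // _; rewrite scaler0.
  rewrite bopE bop_entryE; apply: eq_bigr => k _.
  by rewrite bopE [b k j u]entryE.
have key i j : alpha g (X i j) + (if i == j then e%:C *: (1 : bop H) else 0) =
    \sum_k alpha g (b i k) * alpha g (b k j).
  transitivity (alpha g (\sum_k b i k * b k j)).
    rewrite -bb actD//; last by case: ifP => _ //; exact: (vnaZ M_vna).
    by congr (_ + _); case: ifP => _; rewrite ?act0// actZ// act_unit.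
  rewrite act_sum => [|k]; last exact: (vnaM M_vna).
  by apply: eq_bigr => k _; rewrite (act_mul alpha_action).
(* The adjoint of [alpha g (b i k)] is [alpha g (b k i)], so the form of the image is a sum of
   squared norms indexed by [k]. *)
have -> : \sum_i \sum_j dot (map_mx (alpha g) X i j (xi j)) (xi i) +
    (\sum_i `|xi i| ^+ 2) * e%:C =
    \sum_k `|\sum_j alpha g (b k j) (xi j)| ^+ 2.
  transitivity (\sum_i \sum_j dot ((\sum_k alpha g (b i k) * alpha g (b k j)) (xi j)) (xi i)).
    rewrite mulr_suml -big_split; apply: eq_bigr => i _ /=.
    rewrite [in RHS](bigD1 i)//= [in LHS](bigD1 i)//= addrAC; congr (_ + _).
      by rewrite -key eqxx mxE !bopE dotDl dotZl dot_norm mulrC.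
    apply: eq_bigr => j ji.
    by rewrite -key eq_sym (negbTE ji) addr0 mxE.
  transitivity (\sum_i \sum_k \sum_j dot (alpha g (b k j) (xi j)) (alpha g (b k i) (xi i))).
    apply: eq_bigr => i _; rewrite exchange_big; apply: eq_bigr => j _ /=.
    rewrite bop_sumE dot_suml; apply: eq_bigr => k _.
    by rewrite bopE (act_adjoint alpha_action g (bM i k) (bM k i) (ba i k)).
  rewrite exchange_big; apply: eq_bigr => k _ /=.
  rewrite -dot_norm dot_sumr; apply: eq_bigr => i _.
  by rewrite dot_suml.
by apply: sumr_ge0 => k _; rewrite exprn_ge0.
Qed.

(** With [y] the adjoint of [x], the bound says that [c^2 - y x] is a positive element of [M]; its
    image under [alpha g] is positive by [act_positive] in size one. *)
Lemma act_bound g x (c : R) : M x -> 0 <= c -> (forall u, `|x u| <= c%:C * `|u|) ->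
  forall u, `|alpha g x u| <= c%:C * `|u|.
Proof.
move=> Mx c0 xc u; have [y xy] := exists_adjoint x.
have My := vna_adjoint M_vna Mx xy.
have c0C : 0 <= c%:C :> C by rewrite lecR.
pose X : 'M[bop H]_1 := const_mx ((c ^+ 2)%:C *: (1 : bop H) - y * x).
have Mc : M ((c ^+ 2)%:C *: (1 : bop H)) by exact: (vnaZ M_vna).
have Myx : M (y * x) by exact: (vnaM M_vna).
have := @act_positive g _ X _ _ (fun=> u); rewrite !big_ord1 !mxE actB// actZ// act_unit.
rewrite (act_mul alpha_action)// !bopE dotBl dotZl dot_norm.
have := act_adjoint alpha_action g Mx My xy => /is_adjoint_sym ->.
rewrite dot_norm subr_ge0 => h.
rewrite -(@ler_pXn2r _ 2) ?nnegrE ?mulr_ge0// exprMn -rmorphXn; apply: h.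
- by move=> i j; rewrite mxE; exact: (vnaB M_vna).
- move=> xi; rewrite !big_ord1 mxE !bopE dotBl dotZl dot_norm.
  rewrite (is_adjoint_sym xy) dot_norm subr_ge0 rmorphXn /= -exprMn.
  by rewrite ler_pXn2r ?nnegrE ?mulr_ge0.
Qed.

End action_theory.

(** * Unconditional sums and diagonal operators *)

Section sums.
Variables (R : realType) (I : choiceType).
Local Notation C := R[i].
Implicit Types (f : I -> C).

Lemma sum_bij (p q : I -> I) f : cancel p q -> cancel q p -> abs_summable f ->
  sum ((fun i => f (p i)) : I -> C^o) = sum (f : I -> C^o) :> C.
Proof.
move=> pq qp fS; apply: (@Defs.sum_eq _ _ (f \o p) (sum (f : I -> C^o))).
apply/cvgrPdist_lt => e e0.
have /cvgrPdist_lt /(_ _ e0) [A _ Ah] := sum_cvg fS.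
exists [fset q i | i in A]%fset => // B /= AB.
have -> : partial_sum ((f \o p) : I -> C^o) B =
    partial_sum (f : I -> C^o) [fset p i | i in B]%fset.
  by rewrite !partial_sumE big_imfset//= => ? ? _ _; exact: (can_inj pq).
apply: Ah => /=; apply/fsubsetP => i iA; apply/imfsetP; exists (q i) => /=.
  by apply: (fsubsetP AB); apply/imfsetP; exists i.
by rewrite qp.
Qed.

Lemma abs_summable_sum (J : Type) (r : seq J) (f : J -> I -> C) :
  (forall j, abs_summable (f j)) -> abs_summable (fun i => \sum_(j <- r) f j i).
Proof.
move=> fS; elim: r => [|j r [N rN]].
  by exists 0 => A; rewrite big1// => i _; rewrite big_nil normr0.
have [M fM] := fS j; exists (M + N) => A.
apply: le_trans (lerD (fM A) (rN A)); rewrite -big_split.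
by apply: ler_sum => i _; rewrite big_cons ler_normD.
Qed.

Lemma sum_sum (J : Type) (r : seq J) (f : J -> I -> C) :
  (forall j, abs_summable (f j)) ->
  sum ((fun i => \sum_(j <- r) f j i) : I -> C^o) =
  \sum_(j <- r) sum (f j : I -> C^o) :> C.
Proof.
move=> fS; elim: r => [|j r IH].
  rewrite big_nil (@sum_fin_support _ _ fset0) => [|i _]; last by rewrite big_nil.
  by rewrite big_seq_fset0.
rewrite big_cons -IH -[X in X + _]mul1r.
rewrite -(sum_lin 1 (fS j) (abs_summable_sum r fS)).
by apply: eq_csum => i; rewrite big_cons mul1r.
Qed.

End sums.

Section diagonal.
Variables (R : realType) (I : choiceType) (H : hilbertType R).
Local Notation C := R[i].

Lemma exists_diagonal (D : I -> bop H) (c : R) : 0 <= c ->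
  (forall i u, `|D i u| <= c%:C * `|u|) ->
  exists T : bop (l2 I H), forall f i, T f i = D i (f i).
Proof.
move=> c0 Dc.
have le f (A : {fset I}) : \sum_(i <- A) `|D i (f i)| ^+ 2 <= c%:C ^+ 2 * \sum_(i <- A) `|f i| ^+ 2.
  rewrite mulr_sumr; apply: ler_sum => i _; rewrite -exprMn.
  by rewrite ler_pXn2r ?nnegrE ?mulr_ge0 ?lecR.
have ss (f : l2 I H) : (fun i => D i (f i)) \in @square_summable R I H.
  apply/asboolP; exists (c%:C ^+ 2 * dot f f) => A; apply: (le_trans (le f A)).
  by rewrite ler_wpM2l ?exprn_ge0 ?lecR//; exact: l2_dot_ge.
have [||T TE] := @exists_bop _ _ (fun f : l2 I H => L2 (ss f)) c%:C.
- move=> a f g; apply: l2_eqP => i.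
  rewrite -[LHS]/(D i (a *: f i + g i)) bopD bopZ.
  by rewrite -[RHS]/(a *: D i (f i) + D i (g i)).
- move=> f; rewrite -(@ler_pXn2r _ 2) ?nnegrE ?mulr_ge0 ?lecR// l2_normE.
  apply: l2_dot_le => A; apply: (le_trans (le f A)).
  by rewrite exprMn ler_wpM2l ?exprn_ge0 ?lecR// l2_normE; exact: l2_dot_ge.
by exists T => f i; rewrite TE.
Qed.

End diagonal.

(** * The covariant representation and its matrix entries *)

Section covariant_representation.
Variables (R : realType) (G : groupType) (H : hilbertType R) (M : set (bop H)).
Variable alpha : G -> bop H -> bop H.
Hypothesis M_vna : von_neumann_algebra M.
Hypothesis alpha_action : star_action M alpha.
Local Notation C := R[i].
Local Notation Psi := (diagonal_rep alpha).
Local Notation L := (@translation R G H).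
Implicit Types (g h s t : G) (r : bop H) (x : bop (l2 G H)) (f : l2 G H).

Lemma diagonal_repE r f h : M r -> Psi r f h = alpha h^-1%g r (f h).
Proof.
move=> Mr; have [c c0 rc] := bop_bound r.
(* One bound of [r] serves all diagonal entries, so the operator sought by [xget] exists and the
   default [0] is not taken. *)
have [T TE] := exists_diagonal c0
  (fun h => act_bound M_vna alpha_action h^-1%g Mr c0 rc).
by rewrite /diagonal_rep; case: xgetP => [T' -> ->//|/(_ T)]; case.
Qed.

Lemma diagonal_rep_lin a r1 r2 : M r1 -> M r2 ->
  Psi (a *: r1 + r2) = a *: Psi r1 + Psi r2.
Proof.
move=> M1 M2; apply: bop_eqP => f; apply: l2_eqP => h.
rewrite !bopE -[RHS]/(a *: Psi r1 f h + Psi r2 f h) !diagonal_repE//.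
  by rewrite (act_linear alpha_action).
exact: (vna_lin M_vna).
Qed.

Lemma diagonal_repM r1 r2 : M r1 -> M r2 -> Psi (r1 * r2) = Psi r1 * Psi r2.
Proof.
move=> M1 M2; apply: bop_eqP => f; apply: l2_eqP => h.
rewrite !bopE !diagonal_repE//; first by rewrite (act_mul alpha_action).
exact: (vnaM M_vna).
Qed.

Lemma diagonal_rep0 : Psi 0 = 0.
Proof.
apply: bop_eqP => f; apply: l2_eqP => h.
by rewrite diagonal_repE ?(act0 M_vna alpha_action)//; exact: (vna0 M_vna).
Qed.

Lemma diagonal_rep1 : Psi 1 = 1.
Proof.
apply: bop_eqP => f; apply: l2_eqP => h.
by rewrite diagonal_repE ?(act_unit M_vna alpha_action)//; exact: (vna1 M_vna).
Qed.

Lemma translationE g f h : L g f h = f (g^-1 * h)%g.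
Proof. by []. Qed.

Lemma translationM g h : L g * L h = L (g * h)%g.
Proof.
apply: bop_eqP => f; apply: l2_eqP => t.
by rewrite bopE !translationE invgM mulgA.
Qed.

Lemma translation1 : L 1%g = 1.
Proof. by apply: bop_eqP => f; apply: l2_eqP => t; rewrite translationE invg1 mul1g. Qed.

Lemma translation_adjoint g : is_adjoint (L g) (L g^-1%g).
Proof.
move=> f w; rewrite !l2_dotE.
rewrite -[RHS](@sum_bij _ G (fun h => g^-1 * h)%g (fun h => g * h)%g).
- by apply: eq_csum => h; rewrite !translationE invgK mulVKg.
- exact: mulVKg.
- exact: mulKg.
- exact: l2_abs.
Qed.

Lemma translation_norm g f : `|L g f| = `|f|.
Proof.
apply/eqP; rewrite -(@eqrXn2 _ 2)// -!dot_norm translation_adjoint.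
by rewrite -bop_mulE translationM mulVg translation1.
Qed.

Lemma covariance g r : M r -> L g * Psi r = Psi (alpha g r) * L g.
Proof.
move=> Mr; apply: bop_eqP => f; apply: l2_eqP => h.
rewrite !bopE translationE !diagonal_repE//; last exact: (act_in alpha_action).
by rewrite invgM invgK (act_comp alpha_action).
Qed.

Lemma entry_diagonal_mull r x s t : M r ->
  entry (Psi r * x) s t = alpha s^-1%g r * entry x s t.
Proof. by move=> Mr; apply: bop_eqP => u; rewrite bopE !entryE bopE diagonal_repE. Qed.

Lemma entry_diagonal_mulr r x s t : M r ->
  entry (x * Psi r) s t = entry x s t * alpha t^-1%g r.
Proof.
move=> Mr; apply: bop_eqP => u; rewrite bopE !entryE bopE; congr (x _ _).
apply: l2_eqP => h; rewrite diagonal_repE// !l2_deltaE.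
by case: eqP => [->//|_]; rewrite bop0.
Qed.

Lemma entry_generator g r s t : M r ->
  entry (L g * Psi r) s t = if s == (g * t)%g then alpha t^-1%g r else 0.
Proof.
move=> Mr; rewrite entry_diagonal_mulr//; apply: bop_eqP => u.
rewrite bopE entryE translationE l2_deltaE.
have -> : (g^-1 * s == t)%g = (s == g * t)%g.
  by apply/eqP/eqP => [<-|->]; rewrite ?mulVKg ?mulKg.
by case: ifP.
Qed.

End covariant_representation.

(** * Conditional expectation onto an injective algebra *)

Section conditional_expectation.
Variables (R : realType) (H : hilbertType R) (M : set (bop H)).
Hypothesis M_vna : von_neumann_algebra M.
Local Notation C := R[i].

Lemma vna_operator_system : operator_system M.
Proof.
split; [exact: (vna1 M_vna)|exact: (vna_lin M_vna)|by case: M_vna].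
Qed.

(** Injectivity is applied to the inclusion of [M], viewed as an operator system in [B(H)]. *)
Lemma exists_conditional_expectation : injective_algebra M ->
  exists E : bop H -> bop H,
    [/\ completely_positive_on setT E, forall x, M (E x) & forall x, M x -> E x = x].
Proof.
move=> /(_ H M id vna_operator_system); apply=> //; split=> // n x _ x0.
by move=> xi; under eq_bigr do under eq_bigr do rewrite mxE; exact: x0.
Qed.

Lemma gram_positive n (y z : 'I_n -> bop H) : (forall i, is_adjoint (y i) (z i)) ->
  mx_positive (\matrix_(i, j) (z i * y j)).
Proof.
move=> yz xi.
have -> : \sum_i \sum_j dot ((\matrix_(i, j) (z i * y j)) i j (xi j)) (xi i) =
    dot (\sum_j y j (xi j)) (\sum_i y i (xi i)).
  rewrite dot_sumr; apply: eq_bigr => i _; rewrite dot_suml; apply: eq_bigr => j _.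
  by rewrite mxE bopE (is_adjoint_sym (yz i)).
exact: dot_ge0.
Qed.

Variable E : bop H -> bop H.
Hypothesis E_cp : completely_positive_on setT E.
Hypothesis E_in : forall x, M (E x).
Hypothesis E_id : forall x, M x -> E x = x.

(* Positivity of [E] on the Gram matrix of [m^*, 1, x], at vectors
   [u, - m^* u, t v] whose first two components span its kernel. *)
Lemma conditional_expectation_bimodule m x : M m ->
  E (m * x) = m * E x /\ E (x * m) = E x * m.
Proof.
move=> Mm.
have key m1 m2 x1 x2 : M m1 -> M m2 -> is_adjoint m2 m1 -> is_adjoint x1 x2 ->
    E (m1 * x1) = m1 * E x1 /\ E (x2 * m2) = E x2 * m2.
  move=> M1 M2 m21 x12.
  have Mmm := vnaM M_vna M1 M2; have M_1 := vna1 M_vna.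
  pose y (i : 'I_3) := nth 0 [:: m2; 1; x1] i.
  pose z (i : 'I_3) := nth 0 [:: m1; 1; x2] i.
  have yz i : is_adjoint (y i) (z i).
    by case: i => -[|[|[|//]]] /= i; rewrite /y /z /=.
  have P (u1 u2 u3 : H) := E_cp.2 3%N _ (fun _ _ => I) (gram_positive yz)
    (fun i : 'I_3 => nth 0 [:: u1; u2; u3] i).
  have q u v : dot (E (m1 * x1) v) u - dot (m1 (E x1 v)) u = 0 /\
      dot (E (x2 * m2) u) v - dot (E x2 (m2 u)) v = 0.
    have D0 : 0 <= dot (E (x2 * x1) v) v.
      have := P 0 0 v; rewrite !big_ord_recl !big_ord0 !mxE /=.
      by rewrite !bop0 !(dot0l, dot0r) !(addr0, add0r).
    (* [E] fixes the entries [m1 * m2], [m1], [m2] and [1], so the terms free of [t] cancel. With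
       [P = 0] the two cross terms, which are the two module defects, vanish. *)
    have [|-> h] := @quadratic_ge0 _ 0 (dot (E (x2 * m2) u) v - dot (E x2 (m2 u)) v)
      (dot (E (m1 * x1) v) u - dot (m1 (E x1 v)) u) _ D0.
      move=> t; have := P u (- m2 u) (t *: v).
      rewrite !big_ord_recl !big_ord0 !mxE /= /y /z /= !(mul1r, mulr1).
      rewrite (E_id Mmm) (E_id M1) (E_id M2) (E_id M_1) !bopE.
      rewrite !(bopN, bopZ, bopE) !(dotNl, dotNr, dotZl, dotZr).
      rewrite -!(is_adjoint_sym m21) //.
      congr (_ <= _); rewrite normCK; ring.
    have : `|dot (E (x2 * m2) u) v - dot (E x2 (m2 u)) v| ^+ 2 == 0.
      by rewrite eq_le exprn_ge0// andbT -[X in _ <= X](mul0r (dot (E (x2 * x1) v) v)).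
    by rewrite sqrf_eq0 normr_eq0 => /eqP ->; rewrite rmorph0.
  split; apply: bop_eqP => v; apply: dot_inj => u; apply/eqP; rewrite -subr_eq0; apply/eqP.
    by rewrite bopE (q u v).1.
  by rewrite bopE (q v u).2.
have [m' mm'] := exists_adjoint m; have [x' xx'] := exists_adjoint x.
have Mm' := vna_adjoint M_vna Mm mm'.
split; first by have [] := key _ _ _ _ Mm Mm' (is_adjoint_sym mm') xx'.
by have [] := key _ _ _ _ Mm' Mm mm' (is_adjoint_sym xx').
Qed.

End conditional_expectation.

(** * Finite sums, linear spans and ultraweak functionals *)

Section big_fset.
Variables (I : choiceType) (V : zmodType).

Lemma big_fset_split (A B : {fset I}) (F : I -> V) : (A `<=` B)%fset ->
  \sum_(i <- B) F i = \sum_(i <- A) F i + \sum_(i <- (B `\` A)%fset) F i.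
Proof.
move=> /fsetIidPr AB; rewrite (big_fsetID _ (mem A) B) /=.
congr (_ + _); apply: eq_fbigl => i; rewrite !inE /=; last by rewrite andbC.
by rewrite -[in RHS]AB inE.
Qed.

Lemma big_fset_if (A : {fset I}) (a : I) (v : V) :
  \sum_(i <- A) (if i == a then v else 0) = if a \in A then v else 0.
Proof.
case: ifPn => aA.
  rewrite (bigD1_seq a) ?fset_uniq//= eqxx big1 ?addr0// => i.
  by move=> /negbTE ->.
by rewrite big_seq big1// => i iA; case: eqP => // ia; rewrite -ia iA in aA.
Qed.

End big_fset.

Lemma big_sum2 (V : nmodType) (I J : finType) (q : I + J -> I + J -> V) :
  \sum_a \sum_b q a b =
  (\sum_s \sum_t q (inl s) (inl t) + \sum_s \sum_t q (inl s) (inr t)) +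
  (\sum_s \sum_t q (inr s) (inl t) + \sum_s \sum_t q (inr s) (inr t)).
Proof.
rewrite big_sumType /= -!big_split; congr (_ + _).
  by apply: eq_bigr => s _; rewrite big_sumType.
by apply: eq_bigr => s _; rewrite big_sumType.
Qed.

Section linear_span.
Variables (R : realType) (H : hilbertType R).

Lemma linear_span_sum (A : set (bop H)) (J : Type) (r : seq J)
    (c : J -> R[i]) (a : J -> bop H) :
  (forall j, A (a j)) -> linear_span A (\sum_(j <- r) c j *: a j).
Proof.
move=> Aa; exists (size r), (fun i => c (tnth (in_tuple r) i)),
  (fun i => a (tnth (in_tuple r) i)); split=> //.
by rewrite big_tnth.
Qed.

(** Ultraweak functionals are norm continuous, so norm approximation from the span places the limit
    in the crossed product. *)
Lemma ultraweak_form_le (xi eta : l2 nat H) (y : bop H) (d : R) : 0 <= d ->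
  (forall u, `|y u| <= d%:C * `|u|) ->
  `|ultraweak_form xi eta y| <= d%:C * (dot xi xi + dot eta eta).
Proof.
move=> d0 yd; have d0C : 0 <= d%:C :> R[i] by rewrite lecR.
have h (A : {fset nat}) : \sum_(n <- A) `|dot (y (xi n)) (eta n)| <=
    d%:C * (dot xi xi + dot eta eta).
  apply: (@le_trans _ _ (d%:C * \sum_(n <- A) (`|xi n| ^+ 2 + `|eta n| ^+ 2))).
    rewrite mulr_sumr; apply: ler_sum => n _; apply: (le_trans (dot_CS _ _)).
    apply: (@le_trans _ _ (d%:C * (`|xi n| * `|eta n|))).
      by rewrite mulrA ler_wpM2r.
    rewrite ler_wpM2l// -subr_ge0.
    have -> : `|xi n| ^+ 2 + `|eta n| ^+ 2 - `|xi n| * `|eta n| =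
      (`|xi n| - `|eta n|) ^+ 2 + `|xi n| * `|eta n| by ring.
    apply: addr_ge0; last exact: mulr_ge0.
    by rewrite real_exprn_even_ge0// rpredB ?normr_real.
  by rewrite ler_wpM2l// big_split lerD//; exact: l2_dot_ge.
have ab : abs_summable (fun n => dot (y (xi n)) (eta n)).
  by exists (d%:C * (dot xi xi + dot eta eta)).
apply: (cvgC_le _ (cvg_norm (sum_cvg ab))); apply: nearW => A.
by rewrite partial_sumE (le_trans (ler_norm_sum _ _ _)).
Qed.

End linear_span.

(** * Finite averages: positivity and norm bounds *)

Section averaging.
Variables (R : realType) (G : groupType) (H : hilbertType R) (M : set (bop H)).
Variable alpha : G -> bop H -> bop H.
Hypothesis M_vna : von_neumann_algebra M.
Hypothesis alpha_action : star_action M alpha.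
Variable E : bop H -> bop H.
Hypothesis E_cp : completely_positive_on setT E.
Hypothesis E_in : forall x, M (E x).
Hypothesis E_id : forall x, M x -> E x = x.
Local Notation C := R[i].
Local Notation Psi := (diagonal_rep alpha).
Local Notation L := (@translation R G H).
Implicit Types (g h s t : G) (r : bop H) (x : bop (l2 G H)) (f w : l2 G H).
Implicit Types (A B : {fset G}).

Definition compressed x s t : bop (l2 G H) := Psi (E (entry x s t)).

Lemma compressed_lin a x y s t :
  compressed (a *: x + y) s t = a *: compressed x s t + compressed y s t.
Proof.
rewrite /compressed entry_lin E_cp.1//.
by rewrite (diagonal_rep_lin M_vna alpha_action).
Qed.

Lemma compressed_scalar (c : C) s t :
  compressed (c *: (1 : bop (l2 G H))) s t = if s == t then c *: (1 : bop (l2 G H)) else 0.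
Proof.
have M1 := vna1 M_vna; have Mc := vnaZ M_vna c M1.
(* A scalar is the generator with [g = e] and scalar [r], whose entries are known. *)
have -> : c *: (1 : bop (l2 G H)) = L 1%g * Psi (c *: (1 : bop H)).
  rewrite translation1 mul1r -[c *: (1 : bop H)]addr0.
  rewrite (diagonal_rep_lin M_vna alpha_action)//; last exact: (vna0 M_vna).
  by rewrite (diagonal_rep1 M_vna alpha_action) (diagonal_rep0 M_vna alpha_action) addr0.
rewrite /compressed (entry_generator M_vna alpha_action)// mul1g translation1 mul1r.
case: ifP => _; last by rewrite E_id ?(diagonal_rep0 M_vna alpha_action)//; exact: (vna0 M_vna).
by rewrite (actZ M_vna alpha_action)// (act_unit M_vna alpha_action) E_id.
Qed.

(** Blocks of a positive matrix form a positive matrix, to which [E] and then [alpha h] are applied.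
    The labels [pi] and [p] on an arbitrary finite [J] serve two uses: pairs of a matrix index and a
    group element for complete positivity, and a disjoint union [A + B] for the norm bound. *)
Lemma kernel_positive h n (X : 'M[bop (l2 G H)]_n) (J : finType)
    (pi : J -> 'I_n) (p : J -> G) : mx_positive X -> forall w : J -> H,
  0 <= \sum_a \sum_b
    dot (alpha h (E (entry (X (pi a) (pi b)) (p a) (p b))) (w b)) (w a).
Proof.
move=> X0 w; pose v := @enum_val J predT.
pose Y : 'M[bop H]_#|J| := \matrix_(a, b) entry (X (pi (v a)) (pi (v b))) (p (v a)) (p (v b)).
have Y0 : mx_positive Y.
  (* [W i] gathers the vectors of all labels over the matrix index [i], each at its group
     element. *)
  move=> xi; pose W i := \sum_(a | pi (v a) == i) l2_delta (p (v a)) (xi a).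
  have -> : \sum_a \sum_b dot (Y a b (xi b)) (xi a) = \sum_i \sum_j dot (X i j (W j)) (W i).
    rewrite (partition_big (fun a => pi (v a)) predT)//=; apply: eq_bigr => i _.
    transitivity (\sum_(a | pi (v a) == i) \sum_j \sum_(b | pi (v b) == j)
        dot (X i j (l2_delta (p (v b)) (xi b))) (l2_delta (p (v a)) (xi a))).
      apply: eq_bigr => a /eqP ai.
      rewrite (partition_big (fun b => pi (v b)) predT)//=; apply: eq_bigr => j _.
      by apply: eq_bigr => b /eqP bj; rewrite mxE dot_entry ai bj.
    rewrite exchange_big; apply: eq_bigr => j _ /=.
    rewrite dot_sumr; apply: eq_bigr => a _.
    by rewrite bop_sum dot_suml.
  exact: X0.
have MY i j : M (map_mx E Y i j) by rewrite mxE.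
have := act_positive M_vna alpha_action h MY (E_cp.2 _ Y (fun _ _ => I) Y0)
  (fun a => w (v a)).
rewrite (reindex _ (onW_bij _ (@enum_val_bij J)))/=; congr (_ <= _).
apply: eq_bigr => a _; rewrite (reindex _ (onW_bij _ (@enum_val_bij J)))/=.
by apply: eq_bigr => b _; rewrite !mxE.
Qed.

(** [Psi] is diagonal, so the form is a sum over [h] in [G] of the nonnegative forms of
    [kernel_positive]. *)
Lemma compressed_positive n (X : 'M[bop (l2 G H)]_n) (J : finType)
    (pi : J -> 'I_n) (p : J -> G) : mx_positive X -> forall u : J -> l2 G H,
  0 <= \sum_a \sum_b dot (compressed (X (pi a) (pi b)) (p a) (p b) (u b)) (u a).
Proof.
move=> X0 u.
pose q a b h := dot (compressed (X (pi a) (pi b)) (p a) (p b) (u b) h) (u a h).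
have qS a b : abs_summable (q a b) by exact: l2_abs.
have -> : \sum_a \sum_b dot (compressed (X (pi a) (pi b)) (p a) (p b) (u b)) (u a) =
    sum ((fun h => \sum_a \sum_b q a b h) : G -> C^o).
  rewrite sum_sum => [|a]; last exact: abs_summable_sum.
  by apply: eq_bigr => a _; rewrite sum_sum.
apply: (sum_ge (A0 := fset0)).
  by apply: abs_summable_sum => a; exact: abs_summable_sum.
move=> A _; apply: sumr_ge0 => h _.
under eq_bigr => a _ do under eq_bigr => b _ do
  rewrite /q /compressed (diagonal_repE M_vna alpha_action)//.
exact: kernel_positive.
Qed.

Variable xi : G -> C.
Hypothesis xi_ge0 : forall g, 0 <= xi g.

Lemma xi_conj g : (xi g)^*%R = xi g.
Proof. exact: geC0_conj. Qed.

Definition average A B x : bop (l2 G H) :=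
  \sum_(s <- A) \sum_(t <- B) (xi s * xi t) *: (L s * compressed x s t * L t^-1%g).

Definition mass A : C := \sum_(s <- A) xi s ^+ 2.

Lemma mass_ge0 A : 0 <= mass A.
Proof. by apply: sumr_ge0 => s _; rewrite exprn_ge0. Qed.

Lemma average_lin A B a x y : average A B (a *: x + y) = a *: average A B x + average A B y.
Proof.
rewrite /average scaler_sumr -big_split; apply: eq_bigr => s _ /=.
rewrite scaler_sumr -big_split; apply: eq_bigr => t _ /=.
rewrite compressed_lin mulrDr mulrDl bop_scale_mulr bop_scale_mull scalerDr.
by rewrite !scalerA mulrC.
Qed.

(** The average is the matrix of the compressed entries, sandwiched between
    [f |-> (xi_t L_t^-1 f)_t] over [B] and the adjoint of the analogous map over [A]; these maps
    have squared norms [mass B] and [mass A]. *)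
Lemma dot_average A B x f w : dot (average A B x f) w =
  \sum_(s <- A) \sum_(t <- B)
    dot (compressed x s t (xi t *: L t^-1%g f)) (xi s *: L s^-1%g w).
Proof.
rewrite /average bop_sumE dot_suml; apply: eq_bigr => s _.
rewrite bop_sumE dot_suml; apply: eq_bigr => t _.
rewrite bopE dotZl !bopE translation_adjoint bopZ dotZl dotZr xi_conj.
by rewrite mulrA [xi t * _]mulrC.
Qed.

Lemma diagonal_part (c : C) A (v : A -> l2 G H) :
  \sum_(s : A) \sum_(t : A) dot (compressed (c *: (1 : bop (l2 G H))) (val s) (val t) (v t)) (v s) =
  c * \sum_(s : A) `|v s| ^+ 2.
Proof.
rewrite mulr_sumr; apply: eq_bigr => s _.
rewrite (bigD1 s)//= big1 ?addr0 => [|t ts].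
  by have := compressed_scalar c (val s) (val s); rewrite eqxx => ->; rewrite !bopE dotZl dot_norm.
by rewrite compressed_scalar eq_sym (inj_eq val_inj) (negbTE ts) /= dot0l.
Qed.

Lemma add_conj_ge0 (z r : C) : `|z| <= r -> 0 <= r + r + (z + z^*%R).
Proof.
move=> zr; rewrite -[z + _]opprK subr_ge0.
apply: (@le_trans _ _ `|- (z + z^*%R)|).
  by rewrite real_ler_norm// rpredN add_conj_real.
by rewrite normrN (le_trans (ler_normD _ _))// norm_conjC lerD.
Qed.

(** The form at [(a, b)] is at least [c (|a| - |b|)^2]. This encodes a norm bound as positivity of a
    matrix. *)
Lemma mx2_positive x x' (c : R) : 0 <= c -> is_adjoint x x' ->
  (forall f, `|x f| <= c%:C * `|f|) ->
  mx_positive (\matrix_(i < 2, j < 2) if i == j then c%:C *: (1 : bop (l2 G H))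
    else if i == ord0 then x else x').
Proof.
move=> c0 xx' xc z; have c0C : 0 <= c%:C :> C by rewrite lecR.
rewrite !big_ord_recl !big_ord0 !addr0 !mxE.
set a := z ord0; set b := z (lift ord0 ord0).
rewrite -[X in 0 <= X]/(dot (c%:C *: a) a + dot (x b) a +
  (dot (x' a) b + dot (c%:C *: b) b)) !dotZl !dot_norm.
rewrite (is_adjoint_sym xx') [dot a (x b)]dotC.
have h : `|dot (x b) a| <= c%:C * (`|a| * `|b|).
  by rewrite (le_trans (dot_CS _ _))// [X in c%:C * X]mulrC mulrA ler_wpM2r.
have -> : c%:C * `|a| ^+ 2 + dot (x b) a + ((dot (x b) a)^*%R + c%:C * `|b| ^+ 2) =
  c%:C * (`|a| - `|b|) ^+ 2 +
  (c%:C * (`|a| * `|b|) + c%:C * (`|a| * `|b|) + (dot (x b) a + (dot (x b) a)^*%R)).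
  by ring.
apply: addr_ge0; last exact: add_conj_ge0.
by rewrite mulr_ge0// real_exprn_even_ge0// rpredB ?normr_real.
Qed.

(** In the matrix of [mx2_positive], the first row carries the labels in [A] and the second those in
    [B]. The diagonal blocks give the two masses, the other blocks give the averages of [x] and of
    its adjoint, and scaling the vectors over [B] by [tau] yields the quadratic form of
    [quadratic_ge0]. *)
Lemma average_dot_le A B x (c : R) f w : 0 <= c -> (forall f, `|x f| <= c%:C * `|f|) ->
  `|dot (average A B x f) w| ^+ 2 <=
  (c%:C * (mass A * `|w| ^+ 2)) * (c%:C * (mass B * `|f| ^+ 2)).
Proof.
move=> c0 xc; have c0C : 0 <= c%:C :> C by rewrite lecR.
have [x' xx'] := exists_adjoint x.
have := mx2_positive c0 xx' xc; set X := (X in mx_positive X) => X0.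
have X00 : X ord0 ord0 = c%:C *: (1 : bop (l2 G H)) by rewrite mxE.
have X11 : X ord_max ord_max = c%:C *: (1 : bop (l2 G H)) by rewrite mxE.
have X01 : X ord0 ord_max = x by rewrite mxE.
have X10 : X ord_max ord0 = x' by rewrite mxE.
pose p (a : (A + B)%type) : G := match a with inl s => val s | inr t => val t end.
pose pi (a : (A + B)%type) : 'I_2 := match a with inl s => ord0 | inr t => ord_max end.
pose v (t : B) := xi (val t) *: L (val t)^-1%g f.
pose u (s : A) := xi (val s) *: L (val s)^-1%g w.
have massE (A' : {fset G}) (f' : l2 G H) :
    \sum_(s : A') `|xi (val s) *: L (val s)^-1%g f'| ^+ 2 = mass A' * `|f'| ^+ 2.
  rewrite /mass big_seq_fsetE mulr_suml; apply: eq_bigr => s _.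
  by rewrite normrZ exprMn translation_norm ger0_norm.
have [|tau|-> h] := @quadratic_ge0 _ (c%:C * (mass A * `|w| ^+ 2)) (dot (average B A x' w) f)
  (dot (average A B x f) w) (c%:C * (mass B * `|f| ^+ 2)) _; last by rewrite norm_conjC.
  by rewrite !mulr_ge0 ?mass_ge0 ?exprn_ge0.
pose z (a : (A + B)%type) := match a with inl s => u s | inr t => tau *: v t end.
have := compressed_positive pi p X0 z.
rewrite (big_sum2 (fun a b => dot (compressed (X (pi a) (pi b)) (p a) (p b) (z b)) (z a))).
rewrite /z /pi /p X00 X01 X10 X11 !diagonal_part massE.
have -> : \sum_s \sum_t dot (compressed x (val s) (val t) (tau *: v t)) (u s) =
    tau * dot (average A B x f) w.
  rewrite dot_average big_seq_fsetE mulr_sumr; apply: eq_bigr => s _.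
  rewrite big_seq_fsetE mulr_sumr; apply: eq_bigr => t _.
  by rewrite bopZ dotZl.
have -> : \sum_t \sum_s dot (compressed x' (val t) (val s) (u s)) (tau *: v t) =
    tau^*%R * dot (average B A x' w) f.
  rewrite dot_average big_seq_fsetE mulr_sumr; apply: eq_bigr => s _.
  rewrite big_seq_fsetE mulr_sumr; apply: eq_bigr => t _.
  by rewrite dotZr.
have -> : \sum_t `|tau *: v t| ^+ 2 = `|tau| ^+ 2 * (mass B * `|f| ^+ 2).
  by rewrite -massE mulr_sumr; apply: eq_bigr => t _; rewrite normrZ exprMn.
by congr (_ <= _); ring.
Qed.

Lemma average_norm A B x (c : R) f : 0 <= c -> (forall f, `|x f| <= c%:C * `|f|) ->
  `|average A B x f| ^+ 2 <= c%:C ^+ 2 * (mass A * mass B) * `|f| ^+ 2.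
Proof.
move=> c0 xc; have c0C : 0 <= c%:C :> C by rewrite lecR.
set y := average A B x f.
have r0 : 0 <= c%:C ^+ 2 * (mass A * mass B) * `|f| ^+ 2.
  by rewrite !mulr_ge0 ?mass_ge0 ?exprn_ge0.
have [->|y0] := eqVneq y 0; first by rewrite normr0 expr0n.
have yp : 0 < `|y| ^+ 2 by rewrite exprn_gt0// normr_gt0.
rewrite -(ler_pM2r yp).
have := @average_dot_le A B x c f y c0 xc.
rewrite -/y dot_norm normrX normr_id -expr2 => /le_trans; apply.
by rewrite le_eqVlt; apply/orP; left; apply/eqP; ring.
Qed.

End averaging.

(** * The limit map and its multiplier *)

Section averaging_limit.
Variables (R : realType) (G : groupType) (H : hilbertType R) (M : set (bop H)).
Variable alpha : G -> bop H -> bop H.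
Hypothesis M_vna : von_neumann_algebra M.
Hypothesis alpha_action : star_action M alpha.
Variable E : bop H -> bop H.
Hypothesis E_cp : completely_positive_on setT E.
Hypothesis E_in : forall x, M (E x).
Hypothesis E_id : forall x, M x -> E x = x.
Variable xi : G -> R[i].
Hypothesis xi_ge0 : forall g, 0 <= xi g.
Local Notation C := R[i].
Hypothesis xi_mass :
  partial_sum ((fun g => xi g ^+ 2) : G -> C^o) @ totally --> (1 : C^o).
Local Notation Psi := (diagonal_rep alpha).
Local Notation L := (@translation R G H).
Local Notation avg := (average alpha E xi).
Local Notation mu := (mass xi).
Implicit Types (g h s t : G) (r : bop H) (x : bop (l2 G H)) (f w : l2 G H).
Implicit Types (A B : {fset G}).

Lemma mass_split A B : (A `<=` B)%fset -> mu B = mu A + mu (B `\` A)%fset.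
Proof. exact: big_fset_split. Qed.

Lemma mass_le1 A : mu A <= 1.
Proof.
apply: (cvgC_ge _ xi_mass); exists A => // B /= AB.
by rewrite partial_sumE -/(mu B) (mass_split AB) lerDl mass_ge0.
Qed.

Lemma mass_tail (e : R) : 0 < e -> exists A0, forall A B,
  (A0 `<=` A)%fset -> (A `<=` B)%fset -> mu (B `\` A)%fset <= e%:C.
Proof.
move=> e0; have e0C : 0 < e%:C :> C by rewrite ltcR.
have /cvgrPdist_lt /(_ _ e0C) [A0 _ A0h] := xi_mass.
exists A0 => A B A0A AB; rewrite -[leLHS](addKr (mu A)) -mass_split// addrC.
apply: (@le_trans _ _ (1 - mu A)); first by rewrite lerB// mass_le1.
have := A0h A A0A; rewrite partial_sumE -/(mu A) ger0_norm; first exact: ltW.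
by rewrite subr_ge0 mass_le1.
Qed.

Lemma average_small A B x (c e : R) f : 0 <= c -> 0 <= e ->
  (forall f, `|x f| <= c%:C * `|f|) -> mu A * mu B <= (e ^+ 2)%:C ->
  `|avg A B x f| <= e%:C * (c%:C * `|f|).
Proof.
move=> c0 e0 xc m; have c0C : 0 <= c%:C :> C by rewrite lecR.
have e0C : 0 <= e%:C :> C by rewrite lecR.
rewrite -(@ler_pXn2r _ 2) ?nnegrE ?mulr_ge0// !exprMn.
apply: (le_trans (average_norm M_vna alpha_action E_cp E_in E_id xi_ge0 A B f c0 xc)).
rewrite mulrAC [leRHS]mulrC; apply: ler_wpM2l; last by rewrite -rmorphXn.
by apply: mulr_ge0; rewrite exprn_ge0.
Qed.

Lemma average_bound A B x (c : R) f : 0 <= c ->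
  (forall f, `|x f| <= c%:C * `|f|) -> `|avg A B x f| <= c%:C * `|f|.
Proof.
move=> c0 xc; rewrite -[leRHS]mul1r; apply: (@average_small _ _ _ _ 1) => //.
by rewrite expr1n -[leRHS]mulr1 ler_pM ?mass_ge0 ?mass_le1.
Qed.

(** [A0] is chosen before [x] and [f], so the pointwise limit taken below is a limit in norm. *)
Lemma average_tail (e : R) : 0 < e -> exists A0, forall A B x (c : R) f,
  (A0 `<=` A)%fset -> (A `<=` B)%fset -> 0 <= c ->
  (forall f, `|x f| <= c%:C * `|f|) ->
  `|avg B B x f - avg A A x f| <= e%:C * (c%:C * `|f|).
Proof.
(* The norm of an average is controlled by the square root of a product of masses, hence the
   square. *)
move=> e0; have e2 : 0 < (e / 2) ^+ 2 by rewrite exprn_gt0// divr_gt0.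
have [A0 A0h] := mass_tail e2; exists A0 => A B x c f A0A AB c0 xc.
set D := (B `\` A)%fset; have mD : mu D <= ((e / 2) ^+ 2)%:C by exact: A0h.
(* The square over [B] minus the square over [A] is a union of two rectangles; each has the side [D]
   of small mass and a side of mass at most [1]. *)
have -> : avg B B x f - avg A A x f = avg D B x f + avg A D x f.
  have BB : avg B B x = avg A B x + avg D B x by exact: big_fset_split.
  have BA : avg A B x = avg A A x + avg A D x.
    rewrite /average -big_split; apply: eq_bigr => s _; exact: big_fset_split.
  rewrite BB BA !bop_addE; move: (avg A A x f) => a.
  by rewrite [LHS]addrAC [a + _]addrC addrK addrC.
rewrite (splitr e) rmorphD /= mulrDl; apply: (le_trans (ler_normD _ _)).
have e20 : 0 <= e / 2 by rewrite divr_ge0// ltW.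
apply: lerD; apply: average_small => //.
  by rewrite -[leRHS]mulr1 ler_pM ?mass_ge0 ?mass_le1.
by rewrite -[leRHS]mul1r ler_pM ?mass_ge0 ?mass_le1.
Qed.

Lemma exists_average_limit x : exists Z : bop (l2 G H),
  forall f, avg A A x f @[A --> totally] --> Z f.
Proof.
have [c c0 xc] := bop_bound x.
apply: (@bop_lim _ _ _ totally _ (fun A => avg A A x) c) => [A f|f].
  exact: average_bound.
apply: cauchy_cvg; apply: cauchy_exP => e e0.
have K0 : 0 < c%:C * `|f| + 1 :> C by rewrite ltr_wpDl// mulr_ge0// lecR.
have [er eE] : exists er : R, e / (c%:C * `|f| + 1) = er%:C.
  by exists (complex.Re (e / (c%:C * `|f| + 1))); rewrite RRe_real // gtr0_real// divr_gt0.
have er0 : 0 < er by rewrite -ltcR -eE divr_gt0.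
have [A0 A0h] := average_tail er0.
exists (avg A0 A0 x f); exists A0 => // A /= A0A.
rewrite -ball_normE /= distrC.
apply: (le_lt_trans (A0h A0 A x c f _ _ _ _)) => //.
by rewrite -eE mulrAC ltr_pdivrMr// ltr_pM2l// ltrDl.
Qed.

Definition average_limit x : bop (l2 G H) :=
  xget 0 [set Z : bop (l2 G H) | forall f, avg A A x f @[A --> totally] --> Z f].

Lemma average_limitP x f : avg A A x f @[A --> totally] --> average_limit x f.
Proof.
have [Z ZP] := exists_average_limit x.
by rewrite /average_limit; case: xgetP => [Z' -> //|/(_ Z)]; case.
Qed.

Lemma average_limit_eq x (Z : bop (l2 G H)) :
  (forall f, avg A A x f @[A --> totally] --> Z f) -> average_limit x = Z.
Proof.
move=> ZP; apply: bop_eqP => f.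
exact: (cvg_unique (@norm_hausdorff _ _) (@average_limitP x f) (ZP f)).
Qed.

Lemma average_limit_lin a x y :
  average_limit (a *: x + y) = a *: average_limit x + average_limit y.
Proof.
apply: average_limit_eq => f; rewrite bop_addE bop_scaleE.
under eq_fun do rewrite (average_lin M_vna alpha_action E_cp E_in) bop_addE bop_scaleE.
by apply: cvgD; [apply: cvgZl_tmp|]; exact: average_limitP.
Qed.

(** [compressed_positive] with labels the pairs [(i, s)] and vectors [xi_s L_s^-1 f_i]. *)
Lemma average_positive A n (X : 'M[bop (l2 G H)]_n) : mx_positive X ->
  forall f : 'I_n -> l2 G H,
  0 <= \sum_i \sum_j dot (avg A A (X i j) (f j)) (f i).
Proof.
move=> X0 f; pose p (a : ('I_n * A)%type) : G := val a.2.
pose u (a : ('I_n * A)%type) := xi (p a) *: L (p a)^-1%g (f a.1).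
have := @compressed_positive _ _ _ _ _ M_vna alpha_action _ E_cp E_in _ X _ fst p X0 u.
congr (_ <= _); rewrite -(pair_bigA _ (fun i (s : A) => \sum_b
  dot (compressed alpha E (X i b.1) (val s) (p b) (u b)) (u (i, s))))/=.
apply: eq_bigr => i _; transitivity (\sum_(s : A) \sum_j \sum_(t : A)
    dot (compressed alpha E (X i j) (val s) (val t) (u (j, t))) (u (i, s))).
  apply: eq_bigr => s _; rewrite pair_bigA /=; apply: eq_bigr => -[j t] _ //.
rewrite exchange_big; apply: eq_bigr => j _ /=.
rewrite (dot_average _ _ xi_ge0) big_seq_fsetE; apply: eq_bigr => s _.
by rewrite big_seq_fsetE.
Qed.

Lemma average_limit_cp : completely_positive_on setT average_limit.
Proof.
split=> [a x y _ _|n X _ X0 f]; first exact: average_limit_lin.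
have lim : (\sum_i \sum_j dot (avg A A (X i j) (f j)) (f i) : C^o) @[A --> totally] -->
    (\sum_i \sum_j dot (map_mx average_limit X i j (f j)) (f i) : C^o).
  apply: cvg_big => [|i _]; first exact: add_continuous.
  apply: cvg_big => [|j _]; first exact: add_continuous.
  by rewrite mxE; apply: cvg_dotl; exact: average_limitP.
apply: (cvgC_ge _ lim); apply: nearW => A; exact: average_positive.
Qed.

Lemma average_limit_close (e : R) : 0 < e -> exists A, forall x (c : R) f,
  0 <= c -> (forall f, `|x f| <= c%:C * `|f|) ->
  `|(average_limit x - avg A A x) f| <= e%:C * (c%:C * `|f|).
Proof.
move=> e0; have [A0 A0h] := average_tail e0; exists A0 => x c f c0 xc.
have lim : avg B B x f - avg A0 A0 x f @[B --> totally] -->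
    average_limit x f - avg A0 A0 x f.
  by apply: cvgB; [exact: average_limitP|exact: cvg_cst].
apply: (cvg_norm_le lim); exists A0 => // B /= AB.
exact: A0h.
Qed.

(** The entry at [(s, t)] acquires the factors [alpha_(s^-1)(r1)] and [alpha_(t^-1)(r2)]; [E] lets
    them out, and moving them across [L_s] and [L_t^-1] restores [r1] and [r2]. *)
Lemma average_bimodule A r1 r2 x : M r1 -> M r2 ->
  avg A A (Psi r1 * x * Psi r2) = Psi r1 * avg A A x * Psi r2.
Proof.
move=> M1 M2; rewrite /average mulr_sumr mulr_suml; apply: eq_bigr => s _.
rewrite mulr_sumr mulr_suml; apply: eq_bigr => t _.
rewrite bop_scale_mulr bop_scale_mull; congr (_ *: _).
have Ms := act_in alpha_action s^-1%g M1; have Mt := act_in alpha_action t^-1%g M2.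
rewrite /compressed (entry_diagonal_mulr M_vna alpha_action)//.
rewrite (entry_diagonal_mull M_vna alpha_action)//.
rewrite (conditional_expectation_bimodule M_vna E_cp E_id _ Mt).2.
rewrite (conditional_expectation_bimodule M_vna E_cp E_id _ Ms).1.
have ME := E_in (entry x s t).
rewrite !(diagonal_repM M_vna alpha_action)//; last exact: (vnaM M_vna).
rewrite !mulrA (covariance M_vna alpha_action)// (act_invK alpha_action)//.
rewrite -!mulrA; congr (_ * (_ * (_ * _))).
have Mt' : M (alpha t^-1%g r2) by [].
have := covariance M_vna alpha_action t^-1%g M2 => <-.
by [].
Qed.

Lemma average_limit_bimodule r1 r2 x : M r1 -> M r2 ->
  average_limit (Psi r1 * x * Psi r2) = Psi r1 * average_limit x * Psi r2.
Proof.
move=> M1 M2; apply: average_limit_eq => f.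
under eq_fun do rewrite average_bimodule// !bop_mulE.
by rewrite !bop_mulE; apply: cvg_bop; exact: average_limitP.
Qed.

(** For fixed [t] only [s = g t] contributes, and [L_(gt) Psi(alpha_(t^-1)(r)) L_t^-1 = L_g
    Psi(r)]. *)
Lemma average_generator A g r : M r -> avg A A (L g * Psi r) =
  (\sum_(t <- A) if (g * t)%g \in A then xi (g * t)%g * xi t else 0) *: (L g * Psi r).
Proof.
move=> Mr; rewrite /average exchange_big scaler_suml; apply: eq_bigr => t _ /=.
have Mt := act_in alpha_action t^-1%g Mr.
transitivity (\sum_(s <- A) if s == (g * t)%g
    then (xi (g * t)%g * xi t) *: (L g * Psi r) else 0).
  apply: eq_bigr => s _; rewrite /compressed (entry_generator M_vna alpha_action)//.
  case: eqP => [->|_]; last first.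
    by rewrite (E_id (vna0 M_vna)) (diagonal_rep0 M_vna alpha_action) mulr0 mul0r scaler0.
  rewrite E_id// -translationM -!mulrA; congr (_ *: _); congr (_ * _).
  rewrite mulrA (covariance M_vna alpha_action)// (act_invK alpha_action)//.
  by rewrite -mulrA translationM mulgV translation1 mulr1.
by rewrite big_fset_if; case: ifP => _ //; rewrite scale0r.
Qed.

(** The coefficient of [xi] at [g^-1] in the left regular representation. *)
Definition autocorrelation g : C :=
  sum ((fun t => xi (g * t)%g * xi t) : G -> C^o).

Lemma autocorrelation_summable g h :
  abs_summable (fun t => xi (g * t)%g * xi (h * t)%g).
Proof.
have m1 k A : \sum_(t <- A) xi (k * t)%g ^+ 2 <= 1.
  have := mass_le1 [fset (k * t)%g | t in A]%fset.
  by rewrite /mass big_imfset//= => ? ? _ _; exact: mulgI.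
exists (1 + 1) => A; apply: le_trans (lerD (m1 g A) (m1 h A)).
rewrite -big_split; apply: ler_sum => t _ /=; rewrite ger0_norm ?mulr_ge0//.
move: (xi_ge0 (g * t)%g) (xi_ge0 (h * t)%g); move: (xi _) (xi _) => a b a0 b0.
rewrite -subr_ge0 (_ : _ - _ = (a - b) ^+ 2 + a * b); last by ring.
apply: addr_ge0; last exact: mulr_ge0.
by rewrite real_exprn_even_ge0// rpredB// ger0_real.
Qed.

Lemma average_limit_generator g r : M r ->
  average_limit (L g * Psi r) = autocorrelation g *: (L g * Psi r).
Proof.
move=> Mr; apply: average_limit_eq => f.
under eq_fun do rewrite average_generator// bop_scaleE.
rewrite bop_scaleE; apply: cvgZr_tmp.
have ab : abs_summable (fun t => xi (g * t)%g * xi t).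
  have := autocorrelation_summable g 1%g.
  by under eq_fun do rewrite mul1g.
apply/cvgrPdist_lt => e e0.
have /cvgrPdist_lt /(_ _ e0) [B _ Bh] := sum_cvg ab.
exists (B `|` [fset (g * t)%g | t in B])%fset => // A /=.
(* Once [A] contains both [B] and [g B], the truncated index set of those [t] in [A] with [g t] in
   [A] contains [B]. *)
rewrite fsubUset => /andP[BA gBA].
have -> : \sum_(t <- A) (if (g * t)%g \in A then xi (g * t)%g * xi t else 0) =
    partial_sum ((fun t => xi (g * t)%g * xi t) : G -> C^o) [fset t in A | (g * t)%g \in A]%fset.
  rewrite partial_sumE -big_mkcond /= big_fset_condE //.
apply: Bh; apply/fsubsetP => t tB; rewrite !inE (fsubsetP BA _ tB) /=.
by apply: (fsubsetP gBA); apply/imfsetP; exists t.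
Qed.

Lemma average_limit_crossed_product x : crossed_product M alpha (average_limit x).
Proof.
move=> s e e0; have [c c0 xc] := bop_bound x.
pose K := \sum_(p <- s) (dot p.1 p.1 + dot p.2 p.2).
have K0 : 0 <= K by apply: sumr_ge0 => p _; rewrite addr_ge0 ?dot_ge0.
pose d := e / ((c + 1) * (complex.Re K + 1)).
have KR : 0 <= complex.Re K by exact: complex_Re_ge0.
have d0 : 0 < d by rewrite divr_gt0// mulr_gt0// ltr_wpDl.
have [A Ah] := average_limit_close d0.
exists (avg A A x).
  pose F (p : G * G) := (xi p.1 * xi p.2) *: (L p.1 * compressed alpha E x p.1 p.2 * L p.2^-1%g).
  have -> : avg A A x = \sum_(p <- [seq (a, b) | a <- A, b <- A]) F p.
    by rewrite big_allpairs.
  (* [L_a Psi(m) L_b^-1 = L_(a b^-1) Psi(alpha_b(m))] is a generator of the crossed product. *)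
  apply: linear_span_sum => -[a b] /=; exists (a * b^-1)%g.
  have ME := E_in (entry x a b).
  exists (alpha b (E (entry x a b))); first exact: (act_in alpha_action).
  rewrite -translationM -!mulrA; congr (_ * _).
  rewrite (covariance M_vna alpha_action); last exact: (act_in alpha_action).
  by rewrite -(act_comp alpha_action)// mulVg (act_one alpha_action).
move=> p ps; have dc0 : 0 <= d * c by rewrite mulr_ge0// ltW.
apply: le_lt_trans (ultraweak_form_le p.1 p.2 dc0 _) _.
  by move=> f; rewrite rmorphM /= -mulrA; exact: Ah.
apply: (@le_lt_trans _ _ ((d * c)%:C * K)).
  rewrite ler_wpM2l ?lecR// /K (big_rem p)//= lerDl.
  by apply: sumr_ge0 => q _; rewrite addr_ge0 ?dot_ge0.
rewrite (ge0_complex_Re K0) -rmorphM ltcR.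
have c1 : 0 < c + 1 by rewrite ltr_wpDl.
have K1 : 0 < complex.Re K + 1 by rewrite ltr_wpDl.
have -> a b : d * a * b = e * (a * b) / ((c + 1) * (complex.Re K + 1)).
  by rewrite /d -!mulrA; congr (e * _); rewrite mulrC -mulrA.
by rewrite ltr_pdivrMr ?mulr_gt0// ltr_pM2l//; nra.
Qed.

(** The substitution [t := g_j^-1 t] exhibits the values at [g_i^-1 g_j] as the Gram matrix of the
    translates of [xi]. *)
Lemma autocorrelation_pd : positive_definite autocorrelation.
Proof.
move=> n g c.
have e i j : autocorrelation ((g i)^-1 * g j)%g =
    sum ((fun t => xi ((g i)^-1 * t)%g * xi ((g j)^-1 * t)%g) : G -> C^o).
  rewrite -(@sum_bij _ G (fun t => g j * t)%g (fun t => (g j)^-1 * t)%g).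
  - by apply: eq_csum => t; rewrite mulKg mulgA.
  - exact: mulKg.
  - exact: mulVKg.
  - exact: autocorrelation_summable.
pose q i j t := Num.conj (c i) * c j * (xi ((g i)^-1 * t)%g * xi ((g j)^-1 * t)%g).
have qS i j : abs_summable (q i j).
  have [N Nh] := autocorrelation_summable (g i)^-1 (g j)^-1.
  exists (`|Num.conj (c i) * c j| * N) => A.
  under eq_bigr do rewrite normrM.
  by rewrite -mulr_sumr ler_wpM2l.
have -> : \sum_i \sum_j Num.conj (c i) * c j * autocorrelation ((g i)^-1 * g j)%g =
    sum ((fun t => \sum_i \sum_j q i j t) : G -> C^o).
  rewrite sum_sum => [|i]; last exact: abs_summable_sum.
  apply: eq_bigr => i _; rewrite sum_sum//; apply: eq_bigr => j _.
  rewrite e; have ab := autocorrelation_summable (g i)^-1 (g j)^-1.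
  have z0 : abs_summable (fun _ : G => 0 : C).
    by exists 0 => A; rewrite big1// => ? _; rewrite normr0.
  have := sum_lin (Num.conj (c i) * c j) ab z0.
  rewrite (@sum_fin_support _ _ fset0 (fun _ => 0))// big_seq_fset0 addr0 => <-.
  by apply: eq_csum => t; rewrite addr0.
apply: (sum_ge (A0 := fset0)).
  by apply: abs_summable_sum => i; exact: abs_summable_sum.
move=> A _; apply: sumr_ge0 => t _.
have -> : \sum_i \sum_j q i j t = `|\sum_j c j * xi ((g j)^-1 * t)%g| ^+ 2.
  rewrite normCK rmorph_sum mulr_sumr; apply: eq_bigr => i _.
  rewrite mulr_suml; apply: eq_bigr => j _.
  by rewrite rmorphM /= xi_conj// /q; ring.
exact: exprn_ge0.
Qed.

End averaging_limit.

(** * Word length, geodesics and sphere sizes *)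

Section word_length.
Variables (G : groupType) (S : {fset G}).
Hypothesis S_generates : generates S.
Hypothesis S_symmetric : forall s, s \in S -> (s^-1)%g \in S.
Local Notation len := (word_length S).
Implicit Types (g h s : G).

Lemma word_lengthP g : is_word S g (len g) /\ forall m, is_word S g m -> (len g <= m)%N.
Proof.
have [n gn] := S_generates g.
have ex : exists n, `[< is_word S g n >] by exists n; apply/asboolP.
rewrite /word_length; case: xgetP => [m -> //|/(_ (ex_minn ex))]; case.
case: ex_minnP => m /asboolP gm mP; split=> // p gp; apply: mP; exact/asboolP.
Qed.

Lemma word_length_le g m : is_word S g m -> (len g <= m)%N.
Proof. by have [_] := word_lengthP g; apply. Qed.

Lemma is_word1 : is_word S 1%g 0.
Proof. by exists [::]; split=> //; rewrite big_nil. Qed.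

Lemma is_wordM g h m n : is_word S g m -> is_word S h n -> is_word S (g * h)%g (m + n).
Proof.
move=> [u [<- uS ->]] [v [<- vS ->]]; exists (u ++ v); split.
- by rewrite size_cat.
- by move=> s; rewrite mem_cat => /orP[/uS|/vS].
- by rewrite big_cat.
Qed.

Lemma is_word_gen s : s \in S -> is_word S s 1.
Proof.
by move=> sS; exists [:: s]; split=> // [t|]; rewrite ?inE ?big_seq1// => /eqP ->.
Qed.

Lemma is_wordV g m : is_word S g m -> is_word S (g^-1)%g m.
Proof.
move=> [u [<- uS ->]]; elim: u uS => [|s u IH] uS.
  by rewrite big_nil invg1; exact: is_word1.
rewrite big_cons invgM /= -addn1; apply: is_wordM.
  by apply: IH => t tu; apply: uS; rewrite inE tu orbT.
by apply: is_word_gen; apply: S_symmetric; apply: uS; rewrite mem_head.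
Qed.

Lemma word_length1 : len 1%g = 0%N.
Proof. by apply/eqP; rewrite -leqn0 word_length_le//; exact: is_word1. Qed.

Lemma word_length0 g : len g = 0%N -> g = 1%g.
Proof.
move=> g0; have [+ _] := word_lengthP g; rewrite g0 => -[w [/size0nil -> _ ->]].
by rewrite big_nil.
Qed.

Lemma word_lengthM g h : (len (g * h)%g <= len g + len h)%N.
Proof.
by apply: word_length_le; apply: is_wordM; [have [] := word_lengthP g|have [] := word_lengthP h].
Qed.

Lemma word_lengthV g : len (g^-1)%g = len g.
Proof.
apply/eqP; rewrite eqn_leq; apply/andP; split; apply: word_length_le.
  by apply: is_wordV; have [] := word_lengthP g.
by rewrite -[g in is_word _ g]invgK; apply: is_wordV; have [] := word_lengthP g^-1%g.
Qed.

(** Cut a shortest word of [g] after [i] letters as [g = a b] and take [t = b^-1], so that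
    [g t = a]. Subadditivity of the length makes both upper bounds on the pieces equalities. *)
Lemma geodesic_point g i : (i <= len g)%N ->
  exists t, len (g * t)%g = i /\ len t = (len g - i)%N.
Proof.
move=> ig; have [[w [wn wS gw]] _] := word_lengthP g.
pose a := (\prod_(s <- take i w) s)%g; pose b := (\prod_(s <- drop i w) s)%g.
have gab : g = (a * b)%g by rewrite /a /b -big_cat cat_take_drop.
have la : (len a <= i)%N.
  apply: word_length_le; exists (take i w); split=> //; first by rewrite size_takel// wn.
  by move=> s /mem_take; exact: wS.
have lb : (len b <= len g - i)%N.
  apply: word_length_le; exists (drop i w); split=> //; first by rewrite size_drop wn.
  by move=> s /mem_drop; exact: wS.
have lab := word_lengthM a b; rewrite -gab in lab.
exists b^-1%g; rewrite word_lengthV {1}gab mulgK.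
by split; apply/eqP; rewrite eqn_leq ?la ?lb /=; move: lab la lb ig;
  move: (len a) (len b) (len g) => x y z; lia.
Qed.

(** The recursion through the finite set [S] provides the finiteness; that the filter loses no
    element of length [n] is [sphereP]. *)
Fixpoint sphere n : {fset G} :=
  if n is m.+1 then
    [fset h in [fset (g * s)%g | g in sphere m, s in S] | len h == n]%fset
  else [fset 1%g]%fset.

Lemma sphereP n g : (g \in sphere n) = (len g == n).
Proof.
elim: n g => [|n IH] g /=.
  rewrite inE; apply/eqP/eqP => [->|]; [exact: word_length1|exact: word_length0].
rewrite !inE /=; case: eqP => [gn|]; last by rewrite andbF.
rewrite andbT; apply/imfset2P.
have [[w [wn wS gw]] _] := word_lengthP g.
case/lastP: w wn wS gw => [|w s]; first by rewrite gn.
rewrite size_rcons gn => -[wn] wS gw.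
rewrite -cats1 big_cat big_seq1 /= in gw.
have sS : s \in S by apply: wS; rewrite mem_rcons mem_head.
exists (\prod_(t <- w) t)%g => /=; last by exists s.
rewrite IH eqn_leq; apply/andP; split.
  apply: word_length_le; exists w; split=> // t tw.
  by apply: wS; rewrite mem_rcons inE tw orbT.
rewrite -ltnS -gn gw (leq_trans (word_lengthM _ _))// addnC -add1n leq_add2r.
exact/word_length_le/is_word_gen.
Qed.

Lemma sphereS_factor n h : h \in sphere n.+1 ->
  exists g s, [/\ g \in sphere n, s \in S & h = (g * s)%g].
Proof.
by rewrite !inE => /andP[/imfset2P[/= g gn [s sS ->]] _]; exists g, s.
Qed.

Lemma card_sphereS n b :
  (forall g, g \in sphere n ->
    (count (fun s => len (g * s)%g == n.+1) (enum_fset S) <= b)%N) ->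
  (#|` sphere n.+1| <= #|` sphere n| * b)%N.
Proof.
move=> cb; pose T g := [seq s <- enum_fset S | len (g * s)%g == n.+1].
have sub : {subset enum_fset (sphere n.+1) <=
    [seq (g * s)%g | g <- enum_fset (sphere n), s <- T g]}.
  move=> h hn; have [g [s [gn sS hE]]] := sphereS_factor hn.
  apply/allpairsPdep; exists g, s; split=> //; rewrite mem_filter sS andbT -hE.
  by rewrite -sphereP.
apply: (leq_trans (uniq_leq_size (fset_uniq _) sub)).
rewrite size_allpairs_dep sumnE big_map big_seq.
apply: (@leq_trans (\sum_(g <- enum_fset (sphere n) | g \in enum_fset (sphere n)) b)%N).
  by apply: leq_sum => g gn; rewrite size_filter; exact: cb.
by rewrite -big_seq big_const_seq count_predT iter_addn_0 mulnC.
Qed.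

Lemma card_sphere1_le : (#|` sphere 1| <= #|` S|)%N.
Proof.
rewrite -[leqRHS]mul1n -[X in (_ <= X * _)%N](cardfs1 (1%g : G)).
by apply: card_sphereS => g _; exact: count_size.
Qed.

(* The generator leading back towards the identity is excluded. *)
Lemma card_sphereSS_le n : (#|` sphere n.+2| <= #|` sphere n.+1| * #|` S|.-1)%N.
Proof.
apply: card_sphereS => g gn; have [h [s [hn sS gE]]] := sphereS_factor gn.
rewrite -ltnS (leq_trans _ (leqSpred _))//.
rewrite -[X in (_ < X)%N](count_predC (fun s => len (g * s)%g == n.+2)) -addn1 leq_add2l.
rewrite -has_count; apply/hasP; exists s^-1%g; first exact: S_symmetric.
rewrite /= gE mulgK; move: hn; rewrite sphereP => /eqP ->.
by rewrite -[n.+2]addn2 -[X in X == _]addn0 eqn_add2l.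
Qed.

Lemma card_sphere_le n : (#|` sphere n.+1| <= #|` S| * #|` S|.-1 ^ n)%N.
Proof.
elim: n => [|n IH]; first by rewrite muln1 card_sphere1_le.
by apply: (leq_trans (card_sphereSS_le n)); rewrite expnSr mulnA leq_mul2r IH orbT.
Qed.

End word_length.

(** * Choice of the radial weights *)

Section weights.
Variable R : realType.

Lemma sum_inv_sqr_le2 N : \sum_(n < N) n.+1%:R^-1 ^+ 2 <= 2 :> R.
Proof.
case: N => [|N]; first by rewrite big_ord0.
(* Strengthened for the induction by the telescoping [1 / (x + 1)^2 <= 1 / x - 1 / (x + 1)]. *)
suff h : \sum_(n < N.+1) n.+1%:R^-1 ^+ 2 <= 2 - N.+1%:R^-1 :> R.
  by apply: (le_trans h); rewrite gerBl invr_ge0.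
elim: N => [|N IH]; first by rewrite big_ord_recl big_ord0 invr1 addr0 expr1n lerBrDl.
rewrite big_ord_recr /=; apply: (le_trans (lerD IH (lexx _))).
rewrite -subr_ge0; set x : R := N.+1%:R; have x0 : 0 < x by rewrite ltr0n.
have -> : N.+2%:R = x + 1 by rewrite -natr1.
clearbody x; have x1 : 0 < x + 1 by rewrite ltr_wpDl// ltW.
have -> : 2 - (x + 1)^-1 - (2 - x^-1 + (x + 1)^-1 ^+ 2) = x^-1 * (x + 1)^-1 ^+ 2.
  by field; rewrite !lt0r_neq0.
by rewrite mulr_ge0 ?invr_ge0 ?exprn_ge0 ?invr_ge0// ltW.
Qed.

Lemma inv_mul_ge (x y : R) : 0 < x -> 0 < y -> 4 / (x + y) ^+ 2 <= x^-1 * y^-1.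
Proof.
move=> x0 y0; have xy : 0 < x + y by rewrite addr_gt0.
rewrite -invfM ler_pdivrMr ?exprn_gt0// mulrC ler_pdivlMr ?mulr_gt0//.
by have := sqr_ge0 (x - y); nra.
Qed.

(** With [x = n + 1], the two end terms are [2 / x] each and the [n] inner ones at least [4 / x^2]
    each, in total [8 / x - 4 / x^2 >= 8 / (x + 1)]. The value [a_0 = 2] makes the ends pay for the
    loss inside. *)
Lemma weight_two (a : nat -> R) (n : nat) :
  a 0%N = 2 -> (forall m, a m.+1 = m.+1%:R^-1) ->
  8 / n.+2%:R <= \sum_(i < n.+2) a i * a (n.+1 - i)%N.
Proof.
move=> a0 aS; rewrite -(big_mkord xpredT (fun i => a i * a (n.+1 - i)%N)).
rewrite big_nat_recl// big_nat_recr//= subn0 subnn a0 aS.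
set x : R := n.+1%:R; have x0 : 0 < x by rewrite ltr0n.
have mid : n%:R * (4 / x ^+ 2) <= \sum_(0 <= i < n) a i.+1 * a (n.+1 - i.+1)%N.
  rewrite mulr_natl -[X in _ *+ X]card_ord -sumr_const big_mkord.
  apply: ler_sum => i _; rewrite subSS -(prednK (n := (n - i)%N)) ?subn_gt0// !aS prednK ?subn_gt0//.
  have -> : x = i.+1%:R + (n - i)%:R by rewrite -natrD addSn subnKC// ltnW.
  by apply: inv_mul_ge; rewrite ltr0n// subn_gt0.
have nx : n%:R = x - 1 by rewrite /x -natr1 addrK.
have -> : n.+2%:R = x + 1 by rewrite -natr1.
apply: (@le_trans _ _ (2 * x^-1 + ((x - 1) * (4 / x ^+ 2) + x^-1 * 2))); last first.
  by rewrite lerD2l lerD2r -nx.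
have x1 : 0 < x + 1 by rewrite addr_gt0.
have xge1 : 1 <= x by rewrite ler1n.
clear mid nx; clearbody x.
rewrite ler_pdivrMr// -subr_ge0.
have -> : (2 * x^-1 + ((x - 1) * (4 / x ^+ 2) + x^-1 * 2)) * (x + 1) - 8 =
    (4 * (x - 1)) / x ^+ 2 by field; rewrite lt0r_neq0.
by rewrite divr_ge0 ?exprn_ge0 ?(ltW x0)// mulr_ge0// subr_ge0.
Qed.

Lemma geometric_mass (q : R) N : 1 < q ->
  \sum_(n < N) (q + 1) * q ^+ n * (q^-1 ^+ n.+1) ^+ 2 =
  (q + 1) / (q * (q - 1)) * (1 - q^-1 ^+ N).
Proof.
move=> q1; have q0 : 0 < q by apply: lt_trans q1.
have q1' : 0 < q - 1 by rewrite subr_gt0.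
elim: N => [|N IH]; first by rewrite big_ord0 expr0 subrr mulr0.
rewrite big_ord_recr /= IH !exprVn !exprS.
have : 0 < q ^+ N by rewrite exprn_gt0.
move: (q ^+ N) => y y0; field.
by rewrite !lt0r_neq0.
Qed.

(* [a n] is the weight of a group element of length [n]; by [card_sphere_le],
   [c] bounds the total mass of the squared weights. *)
Lemma exists_weight (k : nat) : exists (a : nat -> R) (c : R),
  [/\ 0 < a 0%N, forall n, 0 <= a n,
      forall N, a 0%N ^+ 2 + \sum_(n < N) (k * k.-1 ^ n)%:R * a n.+1 ^+ 2 <= c &
      forall n, c * length_bound R k n.+1 <= \sum_(i < n.+2) a i * a (n.+1 - i)%N].
Proof.
have [k1|k2] := leqP k 1.
  (* Here [k.-1 = 0], so only the radii [0] and [1] contribute, with mass [1 + k]. *)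
  exists (fun=> 1), (1 + k%:R); split=> // [N|n].
    rewrite expr1n lerD2l; under eq_bigr do rewrite mulr1.
    case: N => [|N]; first by rewrite big_ord0.
    rewrite big_ord_recl /= muln1 big1 ?addr0// => i _.
    by case: k k1 => [|[]]//= _; rewrite mul1n exp0n.
  under eq_bigr do rewrite mulr1.
  rewrite sumr_const card_ord /length_bound; case: k k1 => [|[|//]] _ /=.
    (* For [k = 0] the quotient is [1] when the exponent is odd, and [-2 / 0 = 0] when it is
       even. *)
    rewrite addr0 mul1r !sub0r -signr_odd; case: (odd _).
      by rewrite expr1 -opprD -[1 + 1]/(2 : R) divff ?oppr_eq0 ?pnatr_eq0// ler1n.
    by rewrite expr0 subrr invr0 mulr0 ler0n.
  rewrite subrr expr0n /= sub0r (_ : 1 - 2 = -1 :> R); last by ring.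
  rewrite divff ?oppr_eq0 ?oner_eq0//.
  by rewrite mulr1 -[1 + 1]/(2%:R : R) ler_nat.
have [->|kn2] := eqVneq k 2%N.
  (* [8 = 2^2 + 2 * 2]: two points at each positive radius, and inverse squares of sum at most
     [2]. *)
  exists (fun n => if n is m.+1 then m.+1%:R^-1 else 2), 8; split=> //.
  - by case=> [|n]; rewrite ?invr_ge0.
  - move=> N; have h := sum_inv_sqr_le2 N.
    have -> : \sum_(n < N) (2 * 2.-1 ^ n)%:R * n.+1%:R^-1 ^+ 2 =
        2 * \sum_(n < N) n.+1%:R^-1 ^+ 2 :> R.
      by rewrite mulr_sumr; apply: eq_bigr => i _; rewrite /= exp1n muln1.
    by lra.
  - by move=> n; exact: (@weight_two (fun m => if m is p.+1 then p.+1%:R^-1 else 2)).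
have k3 : (2 < k)%N by rewrite ltn_neqAle eq_sym kn2.
pose q : R := k.-1%:R; have kq : k%:R = q + 1 by rewrite natr1 prednK// ltnW// ltnW.
have q2 : 2 <= q by rewrite ler_nat; case: k k3 {k2 kn2 q kq}.
have q0 : 0 < q by lra.
have q1 : 0 < q - 1 by lra.
(* This [c] is [1 + (q + 1) / (q (q - 1))], the limit of the geometric mass. *)
exists (fun n => q^-1 ^+ n), ((q ^+ 2 + 1) / (q * (q - 1))); split.
- by rewrite expr0.
- by move=> n; rewrite exprn_ge0// invr_ge0 ltW.
- move=> N; under eq_bigr do rewrite natrM kq natrX.
  rewrite geometric_mass; last by lra.
  rewrite expr0 expr1n -subr_ge0.
  have -> : (q ^+ 2 + 1) / (q * (q - 1)) -
      (1 + (q + 1) / (q * (q - 1)) * (1 - q^-1 ^+ N)) =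
      (q + 1) / (q * (q - 1)) * q^-1 ^+ N.
    by move: (q^-1 ^+ N) => y; field; rewrite !lt0r_neq0.
  by rewrite !mulr_ge0 ?invr_ge0 ?exprn_ge0 ?mulr_ge0 ?invr_ge0 ?(ltW q0) ?(ltW q1)// addr_ge0// ltW.
- move=> n; rewrite /length_bound (negbTE kn2) kq addrK.
  have -> : q + 1 - 2 = q - 1 by ring.
  have -> : \sum_(i < n.+2) q^-1 ^+ i * q^-1 ^+ (n.+1 - i) = n.+2%:R * q^-1 ^+ n.+1.
    rewrite mulr_natl -[X in _ *+ X]card_ord -sumr_const; apply: eq_bigr => i _.
    by rewrite -exprD subnKC// -ltnS ltn_ord.
  rewrite exprVn exprS; set z := q ^+ n.+1.
  have zq : q <= z by rewrite -[leLHS]expr1 ler_weXn2l//; lra.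
  have z0 : 0 < z by lra.
  have qz1 : 0 < q * z - 1 by nra.
  have n2 : 2 <= n.+2%:R :> R by rewrite ler_nat.
  (* Two of the [n + 2] equal terms suffice, since [(q^2 - 1) z >= 2 q] for [z >= q >= 2]. *)
  apply: (@le_trans _ _ (2 / z)); last by rewrite ler_wpM2r// invr_ge0 ltW.
  rewrite -subr_ge0.
  have -> : 2 / z - (q ^+ 2 + 1) / (q * (q - 1)) * ((q - 1) / (q * z - 1)) =
      ((q ^+ 2 - 1) * z - 2 * q) / (z * q * (q * z - 1)).
    by field; rewrite !lt0r_neq0.
  by rewrite divr_ge0 ?mulr_ge0 ?(ltW z0) ?(ltW q0) ?(ltW qz1)//; nra.
Qed.

End weights.

(** * The radial unit vector and the lower bound *)

Section radial_vector.
Variables (R : realType) (G : groupType) (S : {fset G}).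
Hypothesis S_generates : generates S.
Hypothesis S_symmetric : forall s, s \in S -> (s^-1)%g \in S.
Local Notation C := R[i].
Local Notation len := (word_length S).
Local Notation k := #|` S|.

Variables (a : nat -> R) (c : R).
Hypothesis a0_gt0 : 0 < a 0%N.
Hypothesis a_ge0 : forall n, 0 <= a n.
Hypothesis a_mass : forall N,
  a 0%N ^+ 2 + \sum_(n < N) (k * k.-1 ^ n)%:R * a n.+1 ^+ 2 <= c.

(** Sorted by length, [A] meets each sphere in at most as many points as [card_sphere_le] allows. *)
Lemma radial_mass (A : {fset G}) : \sum_(g <- A) a (len g) ^+ 2 <= c.
Proof.
pose N := \max_(g <- enum_fset A) len g.
have lenN g : g \in A -> (len g <= N)%N by move=> gA; exact: leq_bigmax_seq.
apply: le_trans (a_mass N).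
have -> : \sum_(g <- A) a (len g) ^+ 2 =
    \sum_(n < N.+1) a n ^+ 2 *+ count (fun g => len g == n) (enum_fset A).
  transitivity (\sum_(g <- A) \sum_(n < N.+1) if len g == n then a n ^+ 2 else 0).
    rewrite [LHS]big_seq [RHS]big_seq; apply: eq_bigr => g gA.
    rewrite (bigD1 (Ordinal (lenN g gA : len g < N.+1)%N))//= eqxx big1 ?addr0// => n ng.
    by case: eqP => // e; case/eqP: ng; apply: val_inj.
  rewrite exchange_big; apply: eq_bigr => n _ /=.
  by rewrite -big_mkcond big_const_seq iter_addr_0.
have cle n : (count (fun g => len g == n) (enum_fset A) <= #|` sphere S n|)%N.
  rewrite -size_filter uniq_leq_size ?filter_uniq ?fset_uniq// => g.
  by rewrite mem_filter sphereP// => /andP[].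
rewrite big_ord_recl /=; apply: lerD.
  by rewrite -mulr_natr ger_pMr ?exprn_gt0// lern1 (leq_trans (cle 0%N))// cardfs1.
apply: ler_sum => n _; rewrite -mulr_natl ler_wpM2r ?exprn_ge0// ler_nat.
by apply: (leq_trans (cle _)); exact: card_sphere_le.
Qed.

Definition radial_norm2 : R := complex.Re (sum ((fun g => (a (len g) ^+ 2)%:C) : G -> C^o)).

Lemma radial_summable : abs_summable (fun g => (a (len g) ^+ 2)%:C).
Proof.
exists c%:C => A; apply: le_trans (_ : (\sum_(g <- A) a (len g) ^+ 2)%:C <= _).
  by rewrite rmorph_sum; apply: ler_sum => g _; rewrite ger0_norm// lecR exprn_ge0.
by rewrite lecR radial_mass.
Qed.

Lemma radial_norm2E : sum ((fun g => (a (len g) ^+ 2)%:C) : G -> C^o) = radial_norm2%:C.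
Proof.
apply: ge0_complex_Re; apply: (sum_ge (A0 := fset0) radial_summable) => A _.
by apply: sumr_ge0 => g _; rewrite lecR exprn_ge0.
Qed.

Lemma radial_norm2_le : radial_norm2 <= c.
Proof.
rewrite -lecR -radial_norm2E; apply: (sum_le radial_summable) => A.
by rewrite -rmorph_sum lecR radial_mass.
Qed.

Lemma radial_norm2_gt0 : 0 < radial_norm2.
Proof.
apply: (@lt_le_trans _ _ (a 0%N ^+ 2)); first by rewrite exprn_gt0.
rewrite -lecR -radial_norm2E.
apply: (sum_ge (A0 := [fset 1%g]%fset) radial_summable) => A A1.
rewrite (big_fset_split _ A1) big_seq_fset1 word_length1// lerDl.
by apply: sumr_ge0 => g _; rewrite lecR exprn_ge0.
Qed.

(** Normalized by the true mass and not by its bound [c], so that the value of [chi] at the identity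
    is exactly [1] and [sigma] is unital. *)
Definition radial (g : G) : C := (a (len g) / Num.sqrt radial_norm2)%:C.

Lemma radial_ge0 g : 0 <= radial g.
Proof. by rewrite lecR divr_ge0// sqrtr_ge0. Qed.

Lemma radialM g h : radial g * radial h = radial_norm2%:C^-1 * (a (len g) * a (len h))%:C.
Proof.
rewrite /radial -rmorphM -fmorphV -rmorphM; congr (_%:C).
rewrite mulrACA -invfM -expr2 sqr_sqrtr; last exact/ltW/radial_norm2_gt0.
by rewrite mulrC.
Qed.

Lemma radial_unit :
  partial_sum ((fun g => radial g ^+ 2) : G -> C^o) @ totally --> (1 : C^o).
Proof.
have Z0 : radial_norm2%:C != 0 :> C by rewrite fmorph_eq0 lt0r_neq0 ?radial_norm2_gt0.
have h := sum_cvg radial_summable; rewrite radial_norm2E in h.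
rewrite -[X in _ --> X](mulVf Z0).
have -> : partial_sum ((fun g => radial g ^+ 2) : G -> C^o) = (fun A =>
    radial_norm2%:C^-1 *: partial_sum ((fun g => (a (len g) ^+ 2)%:C) : G -> C^o) A).
  apply/funext => A; rewrite !partial_sumE scaler_sumr; apply: eq_bigr => g _.
  by rewrite expr2 radialM -expr2.
exact: cvgZl_tmp.
Qed.

Lemma autocorrelation_radial1 : autocorrelation radial 1%g = 1.
Proof.
rewrite /autocorrelation; apply: (@Defs.sum_eq _ _ _ (1 : C^o)).
under eq_fun do rewrite mul1g -expr2.
exact: radial_unit.
Qed.

(** All terms of the autocorrelation are nonnegative, and the sum on the left keeps those at the
    geodesic points. *)
Lemma autocorrelation_radial_ge g n : len g = n ->
  (\sum_(i < n.+1) a i * a (n - i)%N / radial_norm2)%:C <= autocorrelation radial g.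
Proof.
move=> gn; pose t i := xget 1%g [set t | len (g * t)%g = i /\ len t = (len g - i)%N].
have tP i : (i <= n)%N -> len (g * t i)%g = i /\ len (t i) = (n - i)%N.
  rewrite -gn => ig; have [u ut] := geodesic_point S_generates S_symmetric ig.
  by rewrite /t; case: xgetP => [_ ->//|/(_ u)].
pose s := [seq t i | i <- iota 0 n.+1].
(* The points are distinct because [g * t i] has length [i]. *)
have us : uniq s.
  rewrite map_inj_in_uniq ?iota_uniq// => i j; rewrite !mem_iota !add0n !ltnS /= => i_n jn.
  move=> /(congr1 (fun u => len (g * u)%g)).
  by rewrite (tP _ i_n).1 (tP _ jn).1.
pose A0 := [fset u in s]%fset.
have ps : perm_eq (enum_fset A0) s.
  by apply: uniq_perm; rewrite ?fset_uniq// => u; rewrite !inE.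
apply: (sum_ge (A0 := A0)) => [|A A0A].
  have := autocorrelation_summable radial_ge0 radial_unit g 1%g.
  by under eq_fun do rewrite mul1g.
rewrite (big_fset_split _ A0A).
have -> : \sum_(u <- A0) radial (g * u)%g * radial u =
    (\sum_(i < n.+1) a i * a (n - i)%N / radial_norm2)%:C.
  rewrite (perm_big _ ps) /= big_map rmorph_sum -[RHS](big_mkord xpredT (fun i =>
    (a i * a (n - i)%N / radial_norm2)%:C)) /index_iota subn0.
  rewrite [LHS]big_seq [RHS]big_seq; apply: eq_bigr => i.
  rewrite mem_iota add0n ltnS => /andP[_ i_n]; rewrite radialM (tP _ i_n).1 (tP _ i_n).2.
  by rewrite [RHS]rmorphM /= fmorphV mulrC.
by rewrite lerDl; apply: sumr_ge0 => u _; rewrite mulr_ge0 ?radial_ge0.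
Qed.

Lemma autocorrelation_radial_bound :
  (forall n, c * length_bound R k n.+1 <= \sum_(i < n.+2) a i * a (n.+1 - i)%N) ->
  forall g, (length_bound R k (len g))%:C <= autocorrelation radial g.
Proof.
move=> ac g; case gn: (len g) => [|n].
  rewrite (word_length0 S_generates gn) autocorrelation_radial1 -[1]/(1%:C) lecR /length_bound.
  case: eqVneq => [_|k2]; first by rewrite invr1.
  rewrite expr1 -addrA -opprD -[1 + 1]/(2 : R) divff// subr_eq0.
  by rewrite -[2]/(2%:R) eqr_nat.
apply: le_trans (autocorrelation_radial_ge gn); rewrite lecR -mulr_suml.
rewrite ler_pdivlMr ?radial_norm2_gt0//.
(* Replacing [radial_norm2] by the larger [c] requires a nonnegative factor; otherwise the left side
   is at most [0]. *)
have [lb|/ltW lb] := lerP 0 (length_bound R k n.+1).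
  by apply: le_trans (ac n); rewrite mulrC ler_wpM2r// radial_norm2_le.
apply: (@le_trans _ _ 0); first by rewrite mulr_le0_ge0// ltW// radial_norm2_gt0.
by apply: sumr_ge0 => i _; rewrite mulr_ge0.
Qed.

End radial_vector.

Theorem mainTheorem6 (R : realType) (G : groupType) (S : {fset G}) (k : nat)
    (H : hilbertType R) (M : set (bop H)) (alpha : G -> bop H -> bop H)
    (G_countable : countable [set: G])
    (S_generates : generates S)
    (S_symmetric : forall s, s \in S -> (s^-1)%g \in S)
    (S_unit : (1%g : G) \notin S)
    (S_card : #|` S|%fset = k)
    (M_vna : von_neumann_algebra M)
    (M_injective : injective_algebra M)
    (alpha_action : star_action M alpha) :
  exists (sigma : bop (l2 G H) -> bop (l2 G H)) (chi : G -> R[i]),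
    [/\ [/\ sigma 1 = 1,
            completely_positive_on [set: bop (l2 G H)] sigma,
            forall x, crossed_product M alpha (sigma x) &
            forall r s x, M r -> M s ->
              sigma (diagonal_rep alpha r * x * diagonal_rep alpha s) =
              diagonal_rep alpha r * sigma x * diagonal_rep alpha s],
        positive_definite chi,
        forall g r, M r ->
          sigma (translation H g * diagonal_rep alpha r) =
          chi g *: (translation H g * diagonal_rep alpha r) &
        forall g, (length_bound R k (word_length S g))%:C <= chi g].
Proof.
have [E [E_cp E_in E_id]] := exists_conditional_expectation M_vna M_injective.
have [a [c [a0 a_ge0 mass_c geo_c]]] := exists_weight R k.
rewrite -S_card in mass_c geo_c *.
have xi0 := @radial_ge0 R G S a a_ge0.
have xi1 := radial_unit S_generates S_symmetric a0 a_ge0 mass_c.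
pose sigma := average_limit alpha E (radial S a).
have gen g r : M r -> sigma (translation H g * diagonal_rep alpha r) =
    autocorrelation (radial S a) g *: (translation H g * diagonal_rep alpha r).
  exact: (average_limit_generator M_vna alpha_action E_cp E_in E_id xi0 xi1).
exists sigma, (autocorrelation (radial S a)); split=> //.
- split.
  (* [1 = L_e Psi(1)], and the multiplier at the identity is [1]. *)
  + have := gen 1%g 1 (vna1 M_vna).
    rewrite translation1 mul1r (diagonal_rep1 M_vna alpha_action) => ->.
    by rewrite (autocorrelation_radial1 S_generates S_symmetric a0 a_ge0 mass_c) scale1r.
  + exact: (average_limit_cp M_vna alpha_action E_cp E_in E_id xi0 xi1).
  + exact: (average_limit_crossed_product M_vna alpha_action E_cp E_in E_id xi0 xi1).
  + exact: (average_limit_bimodule M_vna alpha_action E_cp E_in E_id xi0 xi1).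
- exact: (autocorrelation_pd xi0 xi1).
- exact: (autocorrelation_radial_bound S_generates S_symmetric a0 a_ge0 mass_c geo_c).
Qed.
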